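(* For a topological group $X$ the following conditions are equivalent: (1) $X$ is $K$-analytic and Baire; (2) $X$ contains a compact normal subgroup $H$ such that the quotient group $X/H$ is Polish; (3) $X$ is $\omega$-narrow and Čech-complete; (4) $X$ is Lindelöf and Čech-complete; (5) $X$ is countably cellular and Čech-complete. If moreover $X$ has countable pseudocharacter, then (1)–(5) are equivalent to (6) $X$ is Polish.
   Context: Topological groups are Hausdorff. A Tychonoff space is Čech-complete if it is homeomorphic to a $G_\delta$-subset of a compact Hausdorff space, and $K$-analytic if it is a continuous image of a Lindelöf Čech-complete space. A space is Baire if countable intersections of open dense sets are dense. A topological group $X$ is $\omega$-narrow if for every nonempty open $U\subseteq X$ there is a countable $C\subseteq X$ with $X=CU=UC$. A space is countably cellular if every family of pairwise disjoint open sets is countable, and has countable pseudocharacter if every singleton is a $G_\delta$-set. *)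

(* Defs.v *)
From HB Require Import structures.
From mathcomp Require Import all_boot all_order all_algebra.
From mathcomp Require Import all_classical all_reals topology borel_hierarchy.
From mathcomp Require Import Rstruct Rstruct_topology.
Set Implicit Arguments. Unset Strict Implicit. Unset Printing Implicit Defensive.
Import Order.TTheory GRing.Theory Num.Theory.
Local Open Scope classical_set_scope.
Local Open Scope ring_scope.

Notation Rreal := Rdefinitions.R.

(* ---------- topological groups (Hausdorff by convention) ---------- *)
Definition topological_group (X : topologicalType) (mul : X -> X -> X)
  (inv : X -> X) (e : X) : Prop :=
  [/\ (forall x y z, mul x (mul y z) = mul (mul x y) z),
      (forall x, mul e x = x) &
      (forall x, mul (inv x) x = e)] /\
  [/\ continuous (fun p : X * X => mul p.1 p.2),
      continuous inv &
      hausdorff_space X].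

Definition normal_subgroup (X : Type) (mul : X -> X -> X) (inv : X -> X)
  (e : X) (H : set X) : Prop :=
  [/\ H e,
      (forall x y, H x -> H y -> H (mul x y)),
      (forall x, H x -> H (inv x)) &
      (forall g h, H h -> H (mul (mul g h) (inv g)))].

Definition coset (X : Type) (mul : X -> X -> X) (H : set X) (x : X) : set X :=
  [set mul x h | h in H].

Definition cosets (X : Type) (mul : X -> X -> X) (H : set X) : Type :=
  {A : set X | exists x, A = coset mul H x}.

Definition coset_proj (X : Type) (mul : X -> X -> X) (H : set X) (x : X)
  : cosets mul H :=
  exist _ (coset mul H x) (ex_intro _ x erefl).

Definition coset_space_open (X : topologicalType) (mul : X -> X -> X) (H : set X)
  (O : set (cosets mul H)) : Prop :=
  open (coset_proj mul H @^-1` O).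
Arguments coset_space_open {X} mul H O.

Definition metric_open (Q : Type) (d : Q -> Q -> Rreal) (A : set Q) : Prop :=
  forall x, A x -> exists2 eps : Rreal, 0 < eps & forall y, d x y < eps -> A y.

Definition polish_on (Q : Type) (op : set (set Q)) : Prop :=
  exists d : Q -> Q -> Rreal,
    [/\ (forall x y, d x y = 0 <-> x = y),
        (forall x y, d x y = d y x),
        (forall x y z, d x z <= d x y + d y z) &
        (forall A, op A <-> metric_open d A)] /\
    [/\
        (forall u : nat -> Q,
           (forall eps : Rreal, 0 < eps -> exists N, forall m n,
               (N <= m)%N -> (N <= n)%N -> d (u m) (u n) < eps) ->
           exists l, forall eps : Rreal, 0 < eps -> exists N, forall n,
               (N <= n)%N -> d (u n) l < eps) &
        (exists2 D : set Q, countable D &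
           forall O, op O -> O !=set0 -> O `&` D !=set0)].

Definition polish (X : topologicalType) : Prop := polish_on (@open X).

Definition embedding (X K : topologicalType) (f : X -> K) : Prop :=
  [/\ continuous f, injective f &
      forall U : set X, open U -> exists2 V : set K, open V & f @` U = V `&` range f].

(* homeomorphic to a G_delta subset of a compact Hausdorff space
   (such a space is automatically Tychonoff) *)
Definition cech_complete (X : topologicalType) : Prop :=
  exists (K : topologicalType) (f : X -> K),
    [/\ compact [set: K], hausdorff_space K, embedding f & Gdelta (range f)].

Definition lindelof (X : topologicalType) : Prop :=
  forall F : set (set X), (forall U, F U -> open U) -> \bigcup_(U in F) U = setT ->
    exists2 G : set (set X), G `<=` F /\ countable G & \bigcup_(U in G) U = setT.

Definition K_analytic (X : topologicalType) : Prop :=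
  exists (Y : topologicalType) (g : Y -> X),
    [/\ lindelof Y, cech_complete Y, continuous g & range g = setT].

Definition baire (X : topologicalType) : Prop :=
  forall U : nat -> set X, (forall n, open (U n) /\ dense (U n)) ->
    dense (\bigcap_n U n).

Definition omega_narrow (X : topologicalType) (mul : X -> X -> X) : Prop :=
  forall U : set X, open U -> U !=set0 ->
    exists2 C : set X, countable C &
      [set mul c u | c in C & u in U] = setT /\
      [set mul u c | u in U & c in C] = setT.

Definition countably_cellular (X : topologicalType) : Prop :=
  forall F : set (set X), (forall U, F U -> open U) ->
    (forall U V, F U -> F V -> U <> V -> U `&` V = set0) -> countable F.

Definition countable_pseudocharacter (X : topologicalType) : Prop :=
  forall x : X, Gdelta [set x].

(* Main.v *)
(** The common intermediate notion is a sequence of families of open sets with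
    dense unions such that every ultrafilter meeting all the families converges.
    A Cech-complete space has one; so does a K-analytic Baire space, by a
    Banach category argument on the Souslin scheme of images of members of
    countable covers. Given such a sequence, nested choices trap a compact set of
    countable character around [e], and omega-narrowness allows one to shrink it
    to a compact normal subgroup [H] which is the intersection of neighbourhoods
    [W n] forming a base at [H]. The two-sided uniformity of the [W n] metrizes
    [X/H], and the density of the unions makes two-sided Cauchy ultrafilters of
    [X] converge, so this metric is complete. Conversely [X -> X/H] is a closed
    map with compact fibres, which pulls the Lindelof property and complete
    sequences of covers back to [X]; the closure of [X] in a cube is then the
    required compactification. Countable cellularity comes from a closing-off
    argument: the [W n] can be chosen small with respect to countably many members
    of a disjoint family which decide all the others. *)
Require Import Defs.
From HB Require Import structures.
From mathcomp Require Import all_boot all_order all_algebra.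
From mathcomp Require Import all_classical all_reals topology borel_hierarchy.
From mathcomp Require Import Rstruct Rstruct_topology normedtype lra.
Set Implicit Arguments.
Unset Strict Implicit.
Unset Printing Implicit Defensive.
Import Order.TTheory GRing.Theory Num.Theory.
Import numFieldNormedType.Exports.
Local Open Scope classical_set_scope.

(** * Ultrafilters and countable choices *)

Lemma dependent_choice_nat (S : Type) (P : S -> Prop) (R : nat -> S -> S -> Prop)
    (s0 : S) :
  P s0 -> (forall n s, P s -> exists2 s', P s' & R n s s') ->
  exists f : nat -> S, f 0%N = s0 /\ forall n, P (f n) /\ R n (f n) (f n.+1).
Proof.
move=> Ps0 step.
pose T := {s | P s}.
have [h hP] : {h : nat -> T -> T | forall n t, R n (sval t) (sval (h n t))}.
  have H (nt : nat * T) : {t' : T | R nt.1 (sval nt.2) (sval t')}.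
    case: nt => n [s Ps] /=; apply: cid.
    by have [s' Ps' Rs] := step n s Ps; exists (exist _ s' Ps').
  by exists (fun n t => sval (H (n, t))) => n t; exact: (svalP (H (n, t))).
pose F := fix F n := if n is m.+1 then h m (F m) else exist _ s0 Ps0.
exists (fun n => sval (F n)); split=> // n; split; first exact: svalP.
exact: hP.
Qed.

Lemma decreasing_le (T : Type) (P : nat -> set T) :
  (forall n, P n.+1 `<=` P n) -> forall m n, (m <= n)%N -> P n `<=` P m.
Proof.
move=> dP m n; elim: n => [|n IHn]; first by rewrite leqn0 => /eqP ->.
rewrite leq_eqVlt => /orP[/eqP -> //|/IHn h]; exact: subset_trans (dP n) h.
Qed.

Lemma ultra_of_base (T I : Type) (D : set I) (B : I -> set T) :
  D !=set0 ->
  (forall i j, D i -> D j -> exists2 k, D k & B k `<=` B i `&` B j) ->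
  (forall i, D i -> B i !=set0) ->
  exists2 F, UltraFilter F & forall i, D i -> F (B i).
Proof.
move=> D0 Bdir B0.
have FF : ProperFilter (filter_from D B).
  by apply: filter_from_proper => //; exact: filter_from_filter.
have [G [GU FG]] := ultraFilterLemma FF.
by exists G => // i Di; apply: FG; exists i.
Qed.

Lemma ultra_of_decreasing (T : Type) (P : nat -> set T) :
  (forall n, P n.+1 `<=` P n) -> (forall n, P n !=set0) ->
  exists2 F, UltraFilter F & forall n, F (P n).
Proof.
move=> /decreasing_le dP P0.
have [||//|F FU FP] := @ultra_of_base T nat setT P; first by exists 0%N.
- move=> i j _ _; exists (maxn i j) => //.
  by move=> x Px; split; apply: dP Px; rewrite ?leq_maxl ?leq_maxr.
- by exists F => // n; exact: FP.
Qed.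

Lemma ultraP (T : Type) (F : set_system T) : ProperFilter F ->
  (forall A, F A \/ F (~` A)) -> UltraFilter F.
Proof.
move=> FP FC; split=> // G GP FG; apply/seteqP; split => // A GA.
case: (FC A) => // /FG GcA; exfalso.
by apply: (filter_not_empty G); rewrite -(setICr A); exact: filterI.
Qed.

(* The image under [f] of the tensor product of [F] and [G]. *)
Definition ultra_lift2 (S T U : Type) (f : S -> T -> U) (F : set_system S)
    (G : set_system T) : set_system U :=
  [set A | F [set a | G [set b | A (f a b)]]].

Lemma ultra_lift2_ultra (S T U : Type) (f : S -> T -> U) F G :
  UltraFilter F -> UltraFilter G -> UltraFilter (ultra_lift2 f F G).
Proof.
move=> FU GU; apply: ultraP; first split.
- move=> /(filter_ex (F := F))[a] /=.
  by rewrite (_ : [set b | _] = set0) //; exact: filter_not_empty.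
- split.
  + rewrite /ultra_lift2 /=; apply: filterE => a; exact: filterE.
  + move=> A B; rewrite /ultra_lift2 /= => FA FB.
    by apply: filterS2 FA FB => a /= GA GB; apply: filterS2 GA GB.
  + move=> A B AB; rewrite /ultra_lift2 /=; apply: filterS => a /=.
    by apply: filterS => b; exact: AB.
- move=> A; case: (in_ultra_setVsetC [set a | G [set b | A (f a b)]] FU).
    by left.
  move=> FC; right; apply: filterS FC => a /= nGA.
  by case: (in_ultra_setVsetC [set b | A (f a b)] GU).
Qed.

Lemma ultra_map (S T : Type) (f : S -> T) (F : set_system S) :
  UltraFilter F -> UltraFilter (f @ F).
Proof.
move=> FU; apply: ultraP => A; exact: (in_ultra_setVsetC (f @^-1` A) FU).
Qed.

Lemma filter_cvg_closure (T : topologicalType) (F : set_system T) {FF : ProperFilter F}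
    (A : set T) (x : T) :
  F --> x -> F A -> closure A x.
Proof.
by move=> Fx FA B /Fx FB; apply: filter_ex (filterI FA FB).
Qed.

Lemma not_cvg_ultra (T : topologicalType) (F : set_system T) (x : T) :
  UltraFilter F -> ~ (F --> x) -> exists2 N, nbhs x N & F (~` N).
Proof.
move=> FU nF; apply: contrapT => H; apply: nF => N Nx.
case: (in_ultra_setVsetC N FU) => // FN; exfalso; apply: H; by exists N.
Qed.

Lemma countable_enum (T : Type) (C : set T) (x0 : T) : countable C ->
  exists c : nat -> T, C `<=` range c.
Proof.
move=> /countable_injP[f fI].
have /choice[c cP] : forall n, exists x, (exists2 y, C y & f y = n) -> C x /\ f x = n.
  move=> n; have [[y Cy fy]|H] := pselect (exists2 y, C y & f y = n).
    by exists y.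
  by exists x0.
exists c => x Cx; exists (f x) => //.
have [|Cc fc] := cP (f x); first by exists x.
by apply: fI; rewrite ?inE.
Qed.

Lemma countable_setU (T : Type) (A B : set T) :
  countable A -> countable B -> countable (A `|` B).
Proof.
move=> cA cB.
have -> : A `|` B = \bigcup_b (if b then A else B).
  apply/seteqP; split=> x; first by case=> ?; [exists true|exists false].
  by move=> [[] _ ?]; [left|right].
by apply: bigcup_countable => [|[] _]; first exact: countableP.
Qed.

(** * Complete sequences of families of open sets *)

(* Frolik-style completeness; the families are only required to have dense
   unions, so a space with a dense Cech-complete subspace has such a sequence. *)
Definition complete_sequence (X : topologicalType) (U : nat -> set (set X)) :=
  [/\ forall n A, U n A -> open A,
      forall n W, open W -> W !=set0 ->
        exists2 A, U n A & A `&` W !=set0 &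
      forall F : set_system X, UltraFilter F ->
        (forall n, exists2 A, U n A & F A) -> exists x : X, F --> x].

(** Shrink open sets so that each closure lies inside the preceding set, and each set inside [G n]
    and a member of [U n]. An ultrafilter containing them all converges, and its limit lies in every
    closure, hence in every set. *)
Lemma nested_complete (X : topologicalType) U (G : nat -> set X) (W : set X) :
  regular_space X -> complete_sequence U -> (forall n, open (G n) /\ dense (G n)) ->
  open W -> W !=set0 ->
  exists2 P : nat -> set X,
    forall n, [/\ open (P n), P n `<=` W, P n `<=` G n &
                  exists2 A, U n A & P n `<=` A] &
    exists x, forall n, P n x.
Proof.
move=> Xreg [Uo Ud Uc] Go Wo W0.
pose R n (P P' : set X) := [/\ closure P' `<=` P, P' `<=` G n &
   exists2 A, U n A & P' `<=` A].
have [|n P [Po P0]|P [P0 PR]] :=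
    @dependent_choice_nat (set X) (fun P => open P /\ P !=set0) R W.
- by [].
- have [A UA [x [Ax Px]]] := Ud n P Po P0.
  have [y [[Ay Py] Gy]] : (A `&` P) `&` G n !=set0.
    apply: (Go n).2; first by exists x.
    by apply: openI => //; exact: Uo UA.
  have Ny : nbhs y (A `&` P `&` G n).
    apply: open_nbhs_nbhs; split=> //; apply: openI; last exact: (Go n).1.
    by apply: openI => //; exact: Uo UA.
  have [B By BC] := Xreg _ _ Ny.
  exists B^°.
    by split; [exact: open_interior|exists y; exact: By].
  have clB : closure B^° `<=` A `&` P `&` G n.
    by apply: subset_trans BC; apply: closureS; exact: interior_subset.
  split.
  + by move=> z /clB[[]].
  + by move=> z /subset_closure /clB[].
  + by exists A => // z /subset_closure /clB[[]].
have Pdec n : P n.+1 `<=` P n.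
  by move=> z /subset_closure; have [_ [cP _ _]] := PR n; exact: cP.
exists (fun n => P n.+1) => [n|].
  have [_ [_ PG PA]] := PR n; split=> //; first exact: (PR n.+1).1.1.
  by rewrite -P0; exact: decreasing_le.
have [||F FU FP] := @ultra_of_decreasing _ P; first exact: Pdec.
  by move=> n; exact: (PR n).1.2.
have [n|x Fx] := Uc F FU.
  have [_ [_ _ [A UA PA]]] := PR n.
  by exists A => //; exact: filterS PA (FP n.+1).
exists x => n; have [_ [cP _ _]] := PR n.+1; apply: cP.
by apply: filter_cvg_closure Fx _; exact: FP.
Qed.

Lemma baire_of_complete_sequence (X : topologicalType) U :
  regular_space X -> @complete_sequence X U -> baire X.
Proof.
move=> Xreg Uc G Go W W0 Wo.
have [P PP [x Px]] := nested_complete Xreg Uc Go Wo W0.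
exists x; split; first by have [_ PW _ _] := PP 0%N; exact: PW.
by move=> n _; have [_ _ PG _] := PP n; exact: PG.
Qed.

(** [U n] consists of the open sets whose image has its closure in [O n]; it covers by regularity of
    [K]. The image of an ultrafilter meeting every [U n] converges in [K] to a point of all the
    [O n], that is, of the range. *)
Lemma cech_complete_sequence (X : topologicalType) : cech_complete X ->
  exists2 U, complete_sequence U & forall n (x : X), exists2 A, U n A & A x.
Proof.
move=> [K [f [cK hK fE [O Oo fO]]]].
have [fc fi fo] := fE.
pose U n : set (set X) := [set A | open A /\ closure (f @` A) `<=` O n].
have Ucov n x : exists2 A, U n A & A x.
  have Ofx : O n (f x) by have : range f (f x) by []; rewrite fO; exact.
  have Nfx : nbhs (f x) (O n) by exact: open_nbhs_nbhs.
  have [B By BC] := compact_regular hK cK (filterT : nbhs (f x) setT) Nfx.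
  exists (f @^-1` B^°); last exact: By.
  split; first by apply: open_comp (open_interior _) => ? _; exact: fc.
  apply: subset_trans BC; apply: closureS => _ [z Bz <-].
  exact: interior_subset.
exists U => //; split.
- by move=> n A [].
- by move=> n W Wo [x Wx]; have [A UA Ax] := Ucov n x; exists A => //; exists x.
move=> F FU FO.
have fFU : UltraFilter (f @ F) by exact: ultra_map.
have [k [_ fFk]] : [set: K] `&` [set p | f @ F --> p] !=set0.
  by move: cK; rewrite compact_ultra => cK'; apply: cK'; exact: filterT.
have : range f k.
  rewrite fO => n _; have [A [_ AO] FA] := FO n.
  apply: AO; apply: (filter_cvg_closure fFk).
  by apply: (@filterS _ F _ A) FA => x Ax; exists x.
move=> [x _ fxk]; exists x => N; rewrite nbhsE => -[A [Ao Ax] AN].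
have [V Vo fAV] := fo A Ao.
have Vk : V k by have : (f @` A) k by [exists x]; rewrite fAV => -[].
  
have NV : nbhs k V by exact: open_nbhs_nbhs.
apply: (@filterS _ F _ (f @^-1` V)) (fFk V NV) => z Vz; apply: AN.
have : (f @` A) (f z) by rewrite fAV; split=> //; exists z.
by move=> [z' Az' /fi <-].
Qed.

(** * Topological groups *)

Section TopologicalGroup.
Variables (X : topologicalType) (mul : X -> X -> X) (inv : X -> X) (e : X).
Hypothesis hX : topological_group mul inv e.

Local Notation "x ** y" := (mul x y) (at level 40, left associativity).

Lemma gmulA x y z : x ** (y ** z) = x ** y ** z.
Proof. by case: hX => -[]. Qed.

Lemma gmul1 x : e ** x = x.
Proof. by case: hX => -[]. Qed.

Lemma gmulVx x : inv x ** x = e.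
Proof. by case: hX => -[]. Qed.

Lemma gmulxV x : x ** inv x = e.
Proof.
rewrite -[LHS]gmul1 -{1}(gmulVx (inv x)) -gmulA (gmulA (inv x)) gmulVx gmul1.
exact: gmulVx.
Qed.

Lemma gmulx1 x : x ** e = x.
Proof. by rewrite -(gmulVx x) gmulA gmulxV gmul1. Qed.

Lemma gmulKV x y : inv x ** (x ** y) = y.
Proof. by rewrite gmulA gmulVx gmul1. Qed.

Lemma gmulVK x y : x ** (inv x ** y) = y.
Proof. by rewrite gmulA gmulxV gmul1. Qed.

Lemma gmulxK x y : y ** x ** inv x = y.
Proof. by rewrite -gmulA gmulxV gmulx1. Qed.

Lemma gmulxVK x y : y ** inv x ** x = y.
Proof. by rewrite -gmulA gmulVx gmulx1. Qed.

Lemma ginv_uniq x y : x ** y = e -> inv x = y.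
Proof. by move=> xy; rewrite -(gmulx1 (inv x)) -xy gmulKV. Qed.

Lemma ginvK x : inv (inv x) = x.
Proof. by apply: ginv_uniq; exact: gmulVx. Qed.

Lemma ginvM x y : inv (x ** y) = inv y ** inv x.
Proof. by apply: ginv_uniq; rewrite gmulA gmulxK gmulxV. Qed.

Lemma ginv1 : inv e = e.
Proof. by apply: ginv_uniq; exact: gmul1. Qed.

Lemma gmul_nbhs x y A : nbhs (x ** y) A ->
  exists B C, [/\ nbhs x B, nbhs y C & forall b c, B b -> C c -> A (b ** c)].
Proof.
case: hX => _ [mc _ _] /(mc (x, y))[[B C] /= [Bx Cy] BC].
by exists B, C; split=> // b c Bb Cc; exact: (BC (b, c)).
Qed.

Lemma ginv_nbhs x A : nbhs (inv x) A -> nbhs x [set y | A (inv y)].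
Proof. by case: hX => _ [_ ic _] /(ic x). Qed.

Lemma gmull_nbhs x y A : nbhs (x ** y) A -> nbhs y [set z | A (x ** z)].
Proof.
move=> /gmul_nbhs[B [C [Bx Cy BC]]]; apply: filterS Cy => z Cz.
by apply: BC => //; exact: nbhs_singleton.
Qed.

Lemma gmulr_nbhs x y A : nbhs (x ** y) A -> nbhs x [set z | A (z ** y)].
Proof.
move=> /gmul_nbhs[B [C [Bx Cy BC]]]; apply: filterS Bx => z Cz.
by apply: BC => //; exact: nbhs_singleton.
Qed.

Lemma nbhs_left x A : nbhs x A <-> nbhs e [set z | A (x ** z)].
Proof.
split=> H; first by apply: gmull_nbhs; rewrite gmulx1.
have : nbhs x [set z | A (x ** (inv x ** z))].
  by apply: (@gmull_nbhs (inv x) x [set z | A (x ** z)]); rewrite gmulVx.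
by apply: filterS => z /=; rewrite gmulVK.
Qed.

Lemma nbhs_right x A : nbhs x A <-> nbhs e [set z | A (z ** x)].
Proof.
split=> H; first by apply: gmulr_nbhs; rewrite gmul1.
have : nbhs x [set z | A (z ** inv x ** x)].
  by apply: (@gmulr_nbhs x (inv x) [set z | A (z ** x)]); rewrite gmulxV.
by apply: filterS => z /=; rewrite gmulxVK.
Qed.

Lemma gmull_open x A : open A -> open [set z | A (x ** z)].
Proof.
by rewrite !openE => oA z /oA; rewrite /interior => /gmull_nbhs.
Qed.

Lemma gmulr_open x A : open A -> open [set z | A (z ** x)].
Proof.
by rewrite !openE => oA z /oA; rewrite /interior => /gmulr_nbhs.
Qed.

Lemma nbhs_cube A : nbhs e A -> exists V, [/\ nbhs e V,
  forall x, V x -> V (inv x) &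
  forall x y z, V x -> V y -> V z -> A (x ** y ** z)].
Proof.
move=> Ae.
have [B [C [Be Ce BC]]] : exists B C, [/\ nbhs e B, nbhs e C &
    forall b c, B b -> C c -> A (b ** c)] by apply: gmul_nbhs; rewrite gmul1.
have [B1 [C1 [B1e C1e BC1]]] : exists B' C', [/\ nbhs e B', nbhs e C' &
    forall b c, B' b -> C' c -> B (b ** c)] by apply: gmul_nbhs; rewrite gmul1.
pose V0 := B1 `&` C1 `&` C.
have V0e : nbhs e V0 by apply: filterI => //; exact: filterI.
exists (V0 `&` [set x | V0 (inv x)]); split.
- by apply: filterI => //; apply: ginv_nbhs; rewrite ginv1.
- by move=> x [Vx Vix]; split => //=; rewrite ginvK.
- move=> x y z [[[Bx _] _] _] [[[_ Cy] _] _] [[_ Cz] _].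
  by apply: BC => //; exact: BC1.
Qed.

Lemma group_regular : regular_space X.
Proof.
move=> x A /nbhs_left Ax; have [V [Ve Vi V3]] := nbhs_cube Ax.
exists [set y | V (inv x ** y)].
  by apply/nbhs_left; apply: filterS Ve => z Vz /=; rewrite gmulKV.
(* If [y] is in the closure of [x V], then [y V^-1] meets [x V], so [y] is in [x V V]. *)
move=> y; rewrite /closure /= => /(_ [set z | V (inv z ** y)])[].
  apply: (@filterS _ _ _ [set z | V (inv (inv y ** z))]).
    by move=> z /=; rewrite ginvM ginvK.
  apply: (@gmull_nbhs (inv y) y [set z | V (inv z)]); rewrite gmulVx.
  by apply: ginv_nbhs; rewrite ginv1.
move=> z [/= Vxz Vzy].
have := V3 _ _ _ Vxz Vzy (nbhs_singleton Ve).
by rewrite /= gmulx1 -(gmulA (inv x)) gmulVK gmulVK.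
Qed.

(** * The compact subgroup attached to a sequence of neighbourhoods *)

(* Any filter containing all [V n] clusters, so the [V n] trap a compact set
   of countable character around [e]. *)
Definition trapping (V : nat -> set X) := [/\ forall n, nbhs e (V n) &
  forall F : set_system X, UltraFilter F -> (forall n, F (V n)) ->
    exists x : X, F --> x].

(** The nested sets of [nested_complete] have a common point [p]; translate it to [e]. *)
Lemma complete_trapping U : @complete_sequence X U -> exists V, trapping V.
Proof.
move=> Uc.
have [|||P PP [p Pp]] := @nested_complete X U (fun=> setT) setT group_regular Uc.
- by move=> n; split; [exact: openT|move=> O [x Ox] _; exists x].
- exact: openT.
- by exists e.
- exists (fun n => [set v | P n (p ** v)]); split=> [n|F FU FV].
    apply/(nbhs_left p (P n)); apply: open_nbhs_nbhs; split; last exact: Pp.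
    by have [] := PP n.
  have [_ _ Ucv] := Uc.
  have [n|x Fx] := Ucv ((fun z => p ** z) @ F) (ultra_map _ FU).
    have [_ _ _ [A UA PA]] := PP n; exists A => //.
    by apply: (@filterS _ F _ [set v | P n (p ** v)]) (FV n) => v; exact: PA.
  exists (inv p ** x) => A /(@gmull_nbhs (inv p) x)/Fx.
  by apply: (@filterS X F _ _ A) => z /=; rewrite gmulKV.
Qed.

(* [W] generates a group topology on [X]; the operator [Phi] adds countably many
   further requirements below each member of [W]. *)
Definition nice_sequence (V : nat -> set X) (Phi : set X -> nat -> set X)
    (W : nat -> set X) :=
  [/\ forall n, nbhs e (W n), forall n x, W n x -> W n (inv x),
      forall n x y z, W n.+1 x -> W n.+1 y -> W n.+1 z -> W n (x ** y ** z),
      forall n, W n `<=` V n & forall n k, exists m, W m `<=` Phi (W n) k].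

(** Step [n] imposes the requirements of index at most [n] of all the sets built so far. These are
    finitely many, so the new set can be a neighbourhood, yet each requirement is eventually met. *)
Lemma exists_nice_sequence V Phi : (forall n, nbhs e (V n)) ->
  (forall A k, nbhs e A -> nbhs e (Phi A k)) -> exists W, nice_sequence V Phi W.
Proof.
move=> Ve Phie.
pose Psi A k := [set x | forall j, (j <= k)%N -> Phi A j x].
have Psie A k : nbhs e A -> nbhs e (Psi A k).
  move=> Ae; elim: k => [|k IHk].
    apply: filterS (Phie A 0%N Ae) => x Px j.
    by rewrite leqn0 => /eqP ->.
  apply: filterS2 IHk (Phie A k.+1 Ae) => x Px Px1 j.
  by rewrite leq_eqVlt => /orP[/eqP -> //|]; exact: Px.
(* In a state [(w, G)], [w] is the current set and [G k] is the intersection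
   of the requirements on the sets of index [> k] imposed so far. *)
pose P (s : set X * (nat -> set X)) :=
  [/\ nbhs e s.1, forall x, s.1 x -> s.1 (inv x) & forall k, nbhs e (s.2 k)].
pose R n (s s' : set X * (nat -> set X)) := [/\
  forall x y z, s'.1 x -> s'.1 y -> s'.1 z -> s.1 (x ** y ** z),
  s'.1 `<=` V n `&` s.2 n & forall k, s'.2 k = s.2 k `&` Psi s'.1 k].
have step n s : P s -> exists2 s', P s' & R n s s'.
  case: s => w G [/= we wi Ge].
  have wVG : nbhs e (w `&` (V n `&` G n)) by apply: filterI => //; exact: filterI.
  have [w' [we' wi' w3]] := nbhs_cube wVG.
  exists (w', fun k => G k `&` Psi w' k); split=> //=.
  - by move=> k; apply: filterI => //; exact: Psie.
  - by move=> x y z wx wy wz; have [] := w3 x y z wx wy wz.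
  - move=> x wx; have := w3 x e e wx (nbhs_singleton we') (nbhs_singleton we').
    by rewrite !gmulx1 => -[].
have [|f [_ fP]] := @dependent_choice_nat _ P R (setT, fun=> setT) _ step.
  by split=> //= *; exact: filterT.
(* The shift drops the initial [setT] and puts the [n]-th set inside [V n]. *)
exists (fun n => (f n.+1).1); split.
- by move=> n; have [[]] := fP n.+1.
- by move=> n; have [[]] := fP n.+1.
- by move=> n; have [_ []] := fP n.+1.
- by move=> n; have [_ [_ + _]] := fP n => h x /h[].
(* From state [n.+1] on, the requirements of [W n] are recorded, and from index [k] on they include
   the [k]-th one. *)
move=> n k; exists (maxn n.+1 k).
have dec m i : (f (n.+1 + m)%N).2 i `<=` Psi (f n.+1).1 i.
  elim: m => [|m IHm].
    by have [_ [_ _ h]] := fP n; rewrite addn0 h => x [].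
  by have [_ [_ _ h]] := fP (n.+1 + m)%N; rewrite addnS h => x [/IHm].
have [_ [_ h _]] := fP (maxn n.+1 k) => x /h[_].
have le : (n.+1 <= maxn n.+1 k)%N by exact: leq_maxl.
rewrite -{1}(subnKC le) => /dec; apply; exact: leq_maxr.
Qed.

Section NiceSequence.
Variables (V : nat -> set X) (Phi : set X -> nat -> set X) (W : nat -> set X).
Hypothesis (trapV : trapping V) (niceW : nice_sequence V Phi W).

Let H := \bigcap_n W n.

Lemma nice_e n : W n e.
Proof. by case: niceW => We _ _ _ _; exact: nbhs_singleton. Qed.

Lemma nice_prod n x y : W n.+1 x -> W n.+1 y -> W n (x ** y).
Proof.
move=> Wx Wy; case: niceW => _ _ W3 _ _.
by rewrite -(gmulx1 (x ** y)); apply: W3 => //; exact: nice_e.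
Qed.

Lemma nice_decr n : W n.+1 `<=` W n.
Proof. by move=> x Wx; rewrite -(gmulx1 x); apply: nice_prod => //; exact: nice_e. Qed.

Lemma nice_closure n : closure (W n.+1) `<=` W n.
Proof.
move=> x clx; case: niceW => We Wi _ _ _.
have [y [Wy Wxy]] : W n.+1 `&` [set y | W n.+1 (inv x ** y)] !=set0.
  by apply: clx; apply/nbhs_left; apply: filterS (We n.+1) => z /=; rewrite gmulKV.
rewrite -(gmulVK y x) -[X in inv y ** X]ginvK -ginvM.
by apply: nice_prod => //; exact: Wi.
Qed.

Lemma core_e : H e. Proof. by move=> n _; exact: nice_e. Qed.

Lemma core_mul x y : H x -> H y -> H (x ** y).
Proof. by move=> Hx Hy n _; apply: nice_prod; [exact: Hx|exact: Hy]. Qed.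

Lemma core_inv x : H x -> H (inv x).
Proof. by move=> Hx n _; case: niceW => _ Wi _ _ _; apply: Wi; exact: Hx. Qed.

Lemma nice_ultra F : UltraFilter F -> (forall n, F (W n)) ->
  exists2 x : X, H x & F --> x.
Proof.
move=> FU FW; case: niceW => _ _ _ WV _; case: trapV => _ cV.
have [x Fx] := cV F FU (fun n => filterS (WV n) (FW n)).
exists x => // n _; apply: nice_closure; exact: (filter_cvg_closure Fx).
Qed.

Lemma core_compact : compact H.
Proof.
rewrite compact_ultra => F FU FH.
have [|x Hx Fx] := @nice_ultra F FU; last by exists x.
by move=> n; apply: filterS FH => x; exact.
Qed.

(** Otherwise the sets [W n \ O] are nonempty and decreasing, and an ultrafilter containing them
    converges to a point of [H], so that it contains [O] as well. *)
Lemma nice_base O : open O -> H `<=` O -> exists n, W n `<=` O.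
Proof.
move=> Oo HO; apply: contrapT => nW.
have [n x [/nice_decr]|n|F FU FW] := @ultra_of_decreasing X (fun n => W n `\` O).
- by move=> *; split.
- apply: contrapT => n0; apply: nW; exists n => x Wx; apply: contrapT => nOx.
  by apply: n0; exists x.
- have [n|x Hx Fx] := @nice_ultra F FU; first by apply: filterS (FW n) => x [].
  have FO : F O by apply: Fx; apply: open_nbhs_nbhs; split=> //; exact: HO.
  by have [y [Oy [_]]] := filter_ex (filterI FO (FW 0%N)).
Qed.

(** Apply [nice_base] to the product of [A^°] and [H], an open set containing [H]. *)
Lemma nice_small A : nbhs e A ->
  exists n, forall x, W n x -> exists a h, [/\ A a, H h & x = a ** h].
Proof.
move=> Ae; pose O := \bigcup_(h in H) [set x | A^° (x ** inv h)].
have [||n Wn] := @nice_base O.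
- by apply: bigcup_open => h _; apply: gmulr_open; exact: open_interior.
- by move=> h Hh; exists h => //=; rewrite gmulxV.
exists n => x /Wn[h Hh /= Ax]; exists (x ** inv h), h; rewrite gmulxVK; split=> //.
exact: interior_subset.
Qed.

End NiceSequence.

End TopologicalGroup.

(** * Metrization of a sequence of relations *)

Section Metrization.
Local Open Scope ring_scope.
Variables (R : realType) (T : Type) (E : nat -> T -> T -> Prop).
Hypothesis E0 : forall x y, E 0 x y.
Hypothesis Erefl : forall n x, E n x x.
Hypothesis Esym : forall n x y, E n x y -> E n y x.
Hypothesis Ecomp : forall n x y z w,
  E n.+1 x y -> E n.+1 y z -> E n.+1 z w -> E n x w.

Local Notation h n := ((2^-1 : R) ^+ n).

(** A link in [E n] costs [2^-n], and [r] is the total cost. The number [k] of links is kept for the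
    induction in [chain_relation]. *)
Inductive chain : nat -> R -> T -> T -> Prop :=
| chain_nil x : chain 0 0 x x
| chain_cons k n r x y z :
    E n x y -> chain k r y z -> chain k.+1 (h n + r) x z.

Let h_gt0 n : 0 < h n. Proof. by rewrite exprn_gt0 // invr_gt0. Qed.

Let hS n : h n.+1 = h n / 2. Proof. by rewrite exprS mulrC. Qed.

Let h_le m n : (m <= n)%N -> h n <= h m.
Proof. by move=> mn; apply: ler_wiXn2l => //; lra. Qed.

Lemma relation_decr m n x y : (m <= n)%N -> E n x y -> E m x y.
Proof.
elim: n => [|n IHn]; first by rewrite leqn0 => /eqP ->.
rewrite leq_eqVlt => /orP[/eqP -> //|mn Exy].
by apply: IHn => //; apply: Ecomp Exy _ _.
Qed.

Lemma chain_ge0 k r x y : chain k r x y -> 0 <= r.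
Proof. by elim=> // {}k n {}r ? ? ? _ _ r0; rewrite addr_ge0 // ltW. Qed.

Lemma chain_cat k r x y k' r' z : chain k r x y -> chain k' r' y z ->
  exists k'', chain k'' (r + r') x z.
Proof.
elim=> [{}x|{}k n {}r {}x u {}y Exu _ IH] H; first by exists k'; rewrite add0r.
have [k'' H'] := IH H; exists k''.+1; rewrite -addrA.
exact: chain_cons Exu H'.
Qed.

Lemma chain_rev k r x y : chain k r x y -> exists k', chain k' r y x.
Proof.
elim=> [{}x|{}k n {}r {}x u {}y Exu _ [k' H]]; first by exists 0%N; constructor.
rewrite addrC; apply: chain_cat H _.
by rewrite -[h n]addr0; apply: chain_cons (Esym Exu) (chain_nil _).
Qed.

(** The link from [u] to [v] is the one at which the partial sums of the costs reach [t]. *)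
Lemma chain_split k r x y t : chain k.+1 r x y -> 0 <= t -> t <= r ->
  exists k1 k2 r1 r2 m u v,
    [/\ chain k1 r1 x u, E m u v & chain k2 r2 v y] /\
    [/\ (k1 <= k)%N, (k2 <= k)%N, r = r1 + h m + r2, r1 <= t & t <= r1 + h m].
Proof.
elim: k r x t => [|k IHk] r x t.
  move=> H; inversion H as [|k' n r' x' u y' Exu H' e1 e2 e3 e4]; subst.
  inversion H'; subst; rewrite addr0 => t0 tr.
  exists 0%N, 0%N, 0, 0, n, x, y.
  by split; split=> //; rewrite ?addr0 ?add0r //; exact: chain_nil.
move=> H; inversion H as [|k' n r' x' u y' Exu H' e1 e2 e3 e4]; subst.
move=> t0 tr; have [tn|nt] := leP t (h n).
  exists 0%N, k.+1, 0, r', n, x, u.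
  by split; split=> //; rewrite ?add0r //; exact: chain_nil.
have [||k1 [k2 [r1 [r2 [m [p [q [[C1 Epq C2] [k1k k2k -> r1t tr1]]]]]]]]] :=
    IHk r' u (t - h n) H'; [lra|lra|].
exists k1.+1, k2, (h n + r1), r2, m, p, q; split; split=> //.
1: exact: chain_cons Exu C1.
1: by rewrite (leq_trans k2k).
all: lra.
Qed.

(** Cut the chain at half its cost. Both outer pieces cost at most [r / 2], which is less than
    [h n.+1], and are shorter, so induction applies; the middle link costs less than [h n], so its
    index exceeds [n]. [Ecomp] joins the three. *)
Lemma chain_relation k r x y n : chain k r x y -> r < h n -> E n x y.
Proof.
have [N] := ubnP k; elim: N k r x y n => // N IHN [|k] r x y n.
  by move=> _ H _; inversion H; subst.
rewrite ltnS => kN H rn; have r0 := chain_ge0 H.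
have [||k1 [k2 [r1 [r2 [m [p [q [[C1 Epq C2] [k1k k2k rE r1t tr1]]]]]]]]] :=
    @chain_split _ _ _ _ (r / 2) H; [lra|lra|].
have r10 := chain_ge0 C1; have r20 := chain_ge0 C2.
have mn : (n < m)%N.
  rewrite ltnNge; apply/negP => /h_le hh; lra.
have hn := hS n.
apply: (@Ecomp n x p q y).
- by apply: IHN C1 _; [exact: leq_ltn_trans k1k kN|lra].
- exact: relation_decr mn Epq.
- by apply: IHN C2 _; [exact: leq_ltn_trans k2k kN|lra].
Qed.

Lemma pseudometrization : exists d : T -> T -> R,
  [/\ forall x y, 0 <= d x y, forall x y, d x y = d y x,
      forall x y z, d x z <= d x y + d y z,
      forall n x y, d x y < h n -> E n x y &
      forall n x y, E n x y -> d x y <= h n].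
Proof.
pose S x y : set R := [set r | exists k, chain k r x y].
have Slb x y : lbound (S x y) 0 by move=> r [k /chain_ge0].
have S1 n x y : E n x y -> S x y (h n).
  by move=> Exy; exists 1%N; rewrite -[h n]addr0; apply: chain_cons Exy (chain_nil _).
have Sinf x y : has_inf (S x y).
  by split; [exists (h 0); exact: S1|exists 0].
exists (fun x y => inf (S x y)); split.
- by move=> x y; apply: lb_le_inf => //; case: (Sinf x y).
- by move=> x y; congr inf; apply/seteqP; split=> r [k /chain_rev].
- move=> x y z; rewrite addrC -lerBlDr; apply: lb_le_inf; first by case: (Sinf y z).
  move=> r' [k' H']; rewrite lerBlDr addrC -lerBlDr; apply: lb_le_inf.
    by case: (Sinf x y).
  move=> r [k H]; rewrite lerBlDr; apply: ge_inf; first by case: (Sinf x z).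
  exact: chain_cat H H'.
- move=> n x y /inf_lt; case; first by case: (Sinf x y).
  by move=> r [k H] rn; exact: chain_relation H rn.
- by move=> n x y Exy; apply: ge_inf; [case: (Sinf x y)|exact: S1].
Qed.

End Metrization.

(** * The Polish quotient *)

Section Cauchy.
Variables (X : topologicalType) (mul : X -> X -> X) (inv : X -> X) (e : X).
Hypothesis hX : topological_group mul inv e.
Local Notation "x ** y" := (mul x y) (at level 40, left associativity).

Variables (U : nat -> set (set X)) (F : set_system X).
Hypotheses (Uc : complete_sequence U) (FU : UltraFilter F).
Hypothesis Fl : forall A, nbhs e A -> exists a, F [set b | A (inv a ** b)].
Hypothesis Fr : forall A, nbhs e A -> exists a, F [set b | A (b ** inv a)].

Lemma cauchy_left A : nbhs e A ->
  exists2 B, F B & forall a b, B a -> B b -> A (inv a ** b).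
Proof.
move=> /(nbhs_cube hX)[V [Ve Vi V3]]; have [a Fa] := Fl Ve.
exists [set b | V (inv a ** b)] => // b c Vb Vc.
have := V3 _ _ _ (Vi _ Vb) Vc (nbhs_singleton Ve).
by rewrite (gmulx1 hX) (ginvM hX) (ginvK hX) (gmulA hX) (gmulxK hX).
Qed.

Lemma cauchy_right A : nbhs e A ->
  exists2 B, F B & forall a b, B a -> B b -> A (b ** inv a).
Proof.
move=> /(nbhs_cube hX)[V [Ve Vi V3]]; have [a Fa] := Fr Ve.
exists [set b | V (b ** inv a)] => // b c Vb Vc.
have := V3 _ _ _ Vc (Vi _ Vb) (nbhs_singleton Ve).
by rewrite (gmulx1 hX) (ginvM hX) (ginvK hX) (gmulA hX) (gmulxVK hX).
Qed.

Let R n (P P' : set X) := [/\ P' `<=` P, exists2 A, U n A & P' `<=` A &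
  exists2 A, U n A & exists2 B, F B & forall b p, B b -> P' p -> A (b ** p)].

(* If [x] is the limit of [F] in the completion of the group, this shrinks an
   open [P] so that both [P] and [x P] lie in members of [U n]. *)
Lemma cauchy_step n P : open P /\ P !=set0 ->
  exists2 P', open P' /\ P' !=set0 & R n P P'.
Proof.
move=> [Po P0]; case: Uc => Uo Ud _.
have [A UA [p0 [Ap0 Pp0]]] := Ud n P Po P0.
have Oo : open (A `&` P) by apply: openI => //; exact: Uo UA.
have /(nbhs_left hX)/(nbhs_cube hX)[V [Ve Vi V3]] : nbhs p0 (A `&` P).
  by apply: open_nbhs_nbhs.
have [B1 FB1 VB1] : exists2 B, F B &
    forall a b, B a -> B b -> V (inv p0 ** (inv a ** b) ** p0).
  have Ve' : nbhs e [set z | V (inv p0 ** z ** p0)].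
    have /(gmulr_nbhs hX) : nbhs (inv p0 ** p0) V by rewrite (gmulVx hX).
    by move=> /(nbhs_left hX).
  by have [B FB VB] := cauchy_left Ve'; exists B.
have [a B1a] := filter_ex FB1.
(* [w0] approximates the limit of [F] times [p0]; a member of the second [U n] is sought near it. *)
pose w0 := a ** p0.
have [||A' UA' [w [A'w Vw]]] := Ud n [set w | V^° (inv w0 ** w)].
- by apply: gmull_open hX _ _ _; exact: open_interior.
- by exists w0; rewrite /= (gmulVx hX).
have := open_nbhs_nbhs (conj (Uo _ _ UA') A'w).
rewrite -[w in nbhs w](gmul1 hX) => /(gmul_nbhs hX)[D [C [De Cw DC]]].
have [B2 FB2 DB2] := cauchy_right De.
have [a2 [B1a2 B2a2]] := filter_ex (filterI FB1 FB2).
exists (A `&` P `&` [set p | C^° (a2 ** p)]).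
  split.
    by apply: openI => //; apply: gmull_open hX _ _ _; exact: open_interior.
  (* This point is near [p0], hence in [A] and [P]: it equals [p0] times a conjugate of
     [inv a2 ** a], times [inv w0 ** w], and both factors lie in [V]. *)
  exists (inv a2 ** w); split; last by rewrite /= (gmulVK hX).
  have := V3 _ _ _ (VB1 _ _ B1a2 B1a) (interior_subset Vw) (nbhs_singleton Ve).
  rewrite /= (gmulx1 hX) /w0 (ginvM hX) !(gmulA hX) (gmulxV hX) (gmul1 hX).
  by rewrite (gmulxK hX) (gmulxK hX).
split.
- by move=> p [[]].
- by exists A => // p [[]].
- exists A' => //; exists B2 => // b p B2b [_ Cp].
  have := DC _ _ (DB2 _ _ B2a2 B2b) (interior_subset Cp).
  by rewrite (gmulA hX) (gmulxVK hX).
Qed.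

(** An ultrafilter [G] on the shrinking sets converges to some [p]. By the last clause of [R] the
    product of [F] and [G] also meets every [U n], hence converges to some [q]; then [F] converges
    to [q ** inv p]. *)
Lemma cauchy_cvg : exists x : X, F --> x.
Proof.
have Uc' : forall G : set_system X, UltraFilter G ->
  (forall n, exists2 A, U n A & G A) -> exists x : X, G --> x by case: Uc.
have [|P [P0 PP]] := @dependent_choice_nat _ _ R setT _ cauchy_step.
  by split; [exact: openT|exists e].
have [n|n|G GU GP] := @ultra_of_decreasing X P.
- by have [_ []] := PP n.
- by have [[]] := PP n.
have [n|p Gp] := Uc' G GU.
  have [_ [_ [A UA PA] _]] := PP n; exists A => //.
  exact: filterS PA (GP n.+1).
have [n|q Lq] := Uc' _ (ultra_lift2_ultra mul FU GU).
  have [_ [_ _ [A UA [B FB AB]]]] := PP n; exists A => //.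
  apply: filterS FB => b Bb /=; apply: filterS (GP n.+1) => x Px.
  exact: AB.
exists (q ** inv p) => N /(gmul_nbhs hX)[C [D [Cq /(ginv_nbhs hX) Dp CDN]]].
have FC : F [set b | G [set y | C (b ** y)]] := Lq _ Cq.
apply: (@filterS X F _ _ N) FC => b /= GC.
have [y [/= Cby Dy]] := filter_ex (filterI GC (Gp _ Dp)).
by have := CDN _ _ Cby Dy; rewrite (gmulxK hX).
Qed.

End Cauchy.

(** * Normality of the core and the metric on its quotient *)

Section Quotient.
Variables (X : topologicalType) (mul : X -> X -> X) (inv : X -> X) (e : X).
Hypothesis hX : topological_group mul inv e.
Local Notation "x ** y" := (mul x y) (at level 40, left associativity).

Lemma coset_projP H x y : normal_subgroup mul inv e H ->
  coset_proj mul H x = coset_proj mul H y <-> H (inv x ** y).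
Proof.
move=> [He HM Hi _]; split.
  move=> /(congr1 sval) /= exy.
  have : coset mul H y y by exists e => //; rewrite (gmulx1 hX).
  by rewrite -exy => -[h Hh <-]; rewrite (gmulKV hX).
move=> Hxy; apply: eq_exist; apply/seteqP; split=> z [h Hh <-].
  exists (inv (inv x ** y) ** h); first by apply: HM => //; exact: Hi.
  by rewrite (ginvM hX) (ginvK hX) (gmulA hX) (gmulA hX) (gmulxV hX) (gmul1 hX).
exists (inv x ** y ** h); first exact: HM.
by rewrite (gmulA hX) (gmulVK hX).
Qed.

Lemma coset_proj_surj H (A : cosets mul H) : exists x, coset_proj mul H x = A.
Proof.
case: A => A [x Ax]; exists x; apply: eq_exist; by rewrite Ax.
Qed.

Lemma omega_narrow_seq A : omega_narrow mul -> nbhs e A ->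
  exists c : nat -> X, forall x, (exists k u, A u /\ x = c k ** u) /\
    (exists k u, A u /\ x = u ** c k).
Proof.
move=> on Ae; have [|C cC [CA AC]] := on A^° (open_interior A).
  by exists e; exact: Ae.
have [c Cc] := countable_enum e cC.
exists c => x; split.
  have : setT x by []; rewrite -CA => -[z Cz [u Au <-]].
  by have [k _ <-] := Cc z Cz; exists k, u; split=> //; exact: interior_subset.
have : setT x by []; rewrite -AC => -[u Au [z Cz <-]].
by have [k _ <-] := Cc z Cz; exists k, u; split=> //; exact: interior_subset.
Qed.

(** Countably many right translates of [V] cover [X], say by points [c k]. Writing [x = u ** c k]
    with [u] in [V], conjugation by [x] sends [z] into [A] as soon as conjugation by [c k] sends it
    into [V]. *)
Lemma normalizing_requirements : omega_narrow mul ->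
  exists Phi : set X -> nat -> set X, forall A, nbhs e A ->
    (forall k, nbhs e (Phi A k)) /\
    (forall x, exists k, forall z, Phi A k z -> A (x ** z ** inv x)).
Proof.
move=> on; pose Q A (f : nat -> set X) := nbhs e A -> (forall k, nbhs e (f k)) /\
    (forall x, exists k, forall z, f k z -> A (x ** z ** inv x)).
suff /choice[Phi PhiP] : forall A, exists f, Q A f by exists Phi.
move=> A; have [Ae|nAe] := pselect (nbhs e A); last by exists (fun=> setT).
have [V [Ve Vi V3]] := nbhs_cube hX Ae.
have [c cP] := omega_narrow_seq on Ve.
exists (fun k => [set z | V (c k ** z ** inv (c k))]) => _; split.
  move=> k; have /(gmulr_nbhs hX) : nbhs (c k ** inv (c k)) V by rewrite (gmulxV hX).
  by move=> /(nbhs_left hX).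
move=> x; have [_ [k [u [Vu ->]]]] := cP x; exists k => z Vz.
have := V3 _ _ _ Vu Vz (Vi _ Vu).
by rewrite (ginvM hX) !(gmulA hX).
Qed.

Lemma core_normal Phi V W : nice_sequence mul inv e V Phi W ->
  (forall A, nbhs e A ->
    forall x, exists k, forall z, Phi A k z -> A (x ** z ** inv x)) ->
  normal_subgroup mul inv e (\bigcap_n W n).
Proof.
move=> niceW PhiP; split.
- exact: core_e niceW.
- by move=> x y; exact: (core_mul hX niceW).
- by move=> x; exact: (core_inv niceW).
- move=> g h Hh n _; have [We _ _ _ Wm] := niceW.
  have [k kP] := PhiP _ (We n) g; have [m mP] := Wm n k.
  by apply: kP; apply: mP; exact: Hh.
Qed.

Lemma half_expn_lt (R : realType) (r : R) : (0 < r)%R ->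
  exists n, ((2^-1 : R) ^+ n < r)%R.
Proof.
move=> r0; exists (Num.bound r^-1).
rewrite exprVn -[ltRHS]invrK ltf_pV2 ?posrE ?exprn_gt0 ?invr_gt0 //.
exact: upper_nthrootP.
Qed.

(** The pseudometric vanishes exactly between points of one coset, so it descends through
    representatives. The base property of the [W n] identifies the topologies, [cauchy_cvg] gives
    completeness and omega-narrowness gives separability. *)
Lemma core_quotient_polish U V Phi W : @complete_sequence X U -> omega_narrow mul ->
  trapping e V -> nice_sequence mul inv e V Phi W ->
  normal_subgroup mul inv e (\bigcap_n W n) ->
  polish_on (coset_space_open mul (\bigcap_n W n)).
Proof.
move=> Uc on trapV niceW nH; set H := \bigcap_n W n in nH *.
have [He HM Hi Hn] := nH.
have [We Wi W3 _ _] := niceW.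
(* Being two-sided, [E] makes Cauchy sequences of cosets lift to sequences that are Cauchy on both
   sides. The index is shifted so that [E 0] is total. *)
pose E n x y := if n is m.+1 then W m (inv x ** y) /\ W m (x ** inv y) else True.
have [||||d [d0 dC dT dE Ed]] := @pseudometrization Rreal X E.
- by [].
- move=> [//|n] x /=; rewrite (gmulVx hX) (gmulxV hX).
  by split; exact: (nice_e niceW).
- move=> [//|n] x y /= [Wxy Wyx]; split.
    by have := Wi _ _ Wxy; rewrite (ginvM hX) (ginvK hX).
  by have := Wi _ _ Wyx; rewrite (ginvM hX) (ginvK hX).
- move=> [//|n] x y z w /= [Lxy Rxy] [Lyz Ryz] [Lzw Rzw]; split.
    have := W3 _ _ _ _ Lxy Lyz Lzw.
    by rewrite !(gmulA hX) (gmulxK hX) (gmulxK hX).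
  have := W3 _ _ _ _ Rxy Ryz Rzw.
  by rewrite !(gmulA hX) (gmulxVK hX) (gmulxVK hX).
have Enbhs n x : nbhs x [set y | E n x y].
  case: n => [|n] /=; first exact: filterT.
  apply: filterI.
    by apply/(nbhs_left hX); apply: filterS (We n) => z; rewrite /= (gmulKV hX).
  apply/(nbhs_right hX); apply: filterS (We n) => z Wz /=.
  by rewrite (ginvM hX) (gmulA hX) (gmulxV hX) (gmul1 hX); exact: Wi.
have dH x y : d x y = 0%R <-> H (inv x ** y).
  split=> [dxy n _|Hxy].
    have : E n.+1 x y by apply: dE; rewrite dxy exprn_gt0 // invr_gt0.
    by case.
  apply/eqP; rewrite eq_le d0 andbT leNgt; apply/negP => /half_expn_lt[n].
  apply/negP; rewrite -leNgt; apply: Ed; case: n => //= n; split; first exact: Hxy.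
  have : H (x ** (inv x ** y) ** inv x) by exact: Hn.
  by rewrite (gmulVK hX) => /Hi; rewrite (ginvM hX) (ginvK hX); exact.
have /choice[rep repK] : forall A : cosets mul H, exists x, coset_proj mul H x = A.
  exact: coset_proj_surj.
pose dQ A B := d (rep A) (rep B).
have d_repl x y : d (rep (coset_proj mul H x)) y = d x y.
  have /(coset_projP _ _ nH)/dH dx := repK (coset_proj mul H x).
  apply/eqP; rewrite eq_le; apply/andP; split.
    by apply: le_trans (dT _ x _) _; rewrite dx add0r.
  by apply: le_trans (dT _ (rep (coset_proj mul H x)) _) _; rewrite dC dx add0r.
have dQE x y : dQ (coset_proj mul H x) (coset_proj mul H y) = d x y.
  by rewrite /dQ d_repl dC d_repl dC.
(* An open union of cosets containing [x] contains some [x W n]. *)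
have small x O : open O -> (forall y h, O y -> H h -> O (y ** h)) -> O x ->
    exists n, forall y, W n (inv x ** y) -> O y.
  move=> Oo OH Ox.
  have [||n Wn] := @nice_base _ _ _ _ hX _ _ _ trapV niceW [set z | O (x ** z)].
  - exact: gmull_open hX _ _ Oo.
  - by move=> h Hh; exact: OH.
  - by exists n => y /Wn /=; rewrite (gmulVK hX).
have sat (A : set (cosets mul H)) y h : (coset_proj mul H @^-1` A) y -> H h ->
    (coset_proj mul H @^-1` A) (y ** h).
  move=> /= Ay Hh.
  suff <- : coset_proj mul H y = coset_proj mul H (y ** h) by [].
  by apply/(coset_projP _ _ nH); rewrite (gmulKV hX).
exists dQ; split; split.
- move=> A B; rewrite -{2}(repK A) -{2}(repK B) (coset_projP _ _ nH).
  exact: dH.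
- by move=> A B; exact: dC.
- by move=> A B C; exact: dT.
- move=> A; split.
    move=> Ao B; rewrite -(repK B) => AB.
    have [n Wn] := small _ _ Ao (sat A) AB.
    exists ((2^-1 : Rreal) ^+ n.+1)%R; first by rewrite exprn_gt0 // invr_gt0.
    move=> C; rewrite -(repK C) dQE => /dE[/= WBC _].
    exact: Wn WBC.
  move=> Am; rewrite /coset_space_open openE => x /= Ax.
  have [r r0 Ar] := Am _ Ax; have [n nr] := half_expn_lt r0.
  apply: filterS (Enbhs n x) => y Exy; apply: Ar.
  by rewrite dQE; apply: le_lt_trans nr; exact: Ed.
- move=> u uC; pose x n := rep (u n).
  have xC n : exists N, forall i j, (N <= i)%N -> (N <= j)%N -> E n (x i) (x j).
    have [|N NP] := uC ((2^-1 : Rreal) ^+ n)%R; first by rewrite exprn_gt0 // invr_gt0.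
    by exists N => i j Ni Nj; apply: dE; exact: NP.
  pose T N := [set x n | n in [set n | (N <= n)%N]].
  have [N _ [n Nn <-]|N|F FU FT] := @ultra_of_decreasing X T.
  - by exists n => //; exact: ltnW.
  - by exists (x N), N => /=.
  (* The quotients [inv a ** b] along [F] lie eventually in every [W n], so they converge to some
     [h] in [H]. Hence for a suitable [a] the filter [F] is concentrated near [a ** h]. *)
  have Fl A : nbhs e A -> exists a, F [set b | A (inv a ** b)].
    move=> Ae.
    have [n|h Hh Lh] := nice_ultra hX trapV niceW
      (ultra_lift2_ultra (fun a b => inv a ** b) FU FU).
      have [N NP] := xC n.+1; apply: filterS (FT N) => _ [i Ni <-] /=.
      by apply: filterS (FT N) => _ [j Nj <-] /=; have [] := NP i j Ni Nj.
    have hA : nbhs h [set z | A (inv h ** z)].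
      by apply/(nbhs_left hX); apply: filterS Ae => z /=; rewrite (gmulKV hX).
    have LA : F [set a | F [set b | A (inv h ** (inv a ** b))]] := Lh _ hA.
    have [a Fa] := filter_ex LA; exists (a ** h).
    by apply: filterS Fa => b /=; rewrite (ginvM hX) (gmulA hX).
  have Fr A : nbhs e A -> exists a, F [set b | A (b ** inv a)].
    move=> Ae.
    have [n|h Hh Lh] := nice_ultra hX trapV niceW
      (ultra_lift2_ultra (fun a b => b ** inv a) FU FU).
      have [N NP] := xC n.+1; apply: filterS (FT N) => _ [i Ni <-] /=.
      by apply: filterS (FT N) => _ [j Nj <-] /=; have [] := NP j i Nj Ni.
    have hA : nbhs h [set z | A (z ** inv h)].
      by apply/(nbhs_right hX); apply: filterS Ae => z /=; rewrite (gmulxK hX).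
    have LA : F [set a | F [set b | A (b ** inv a ** inv h)]] := Lh _ hA.
    have [a Fa] := filter_ex LA; exists (h ** a).
    by apply: filterS Fa => b /=; rewrite (ginvM hX) (gmulA hX).
  have [l Fx] := cauchy_cvg hX Uc FU Fl Fr.
  exists (coset_proj mul H l) => r r0.
  have r20 : (0 < r / 2)%R by rewrite divr_gt0.
  have [n nr] := half_expn_lt r20; have [N NP] := uC _ r20.
  exists N => i Ni.
  have [_ [[j Nj <-] Elj]] := filter_ex (filterI (FT N) (Fx _ (Enbhs n l))).
  rewrite /dQ dC d_repl dC.
  have dij := NP i j Ni Nj; have dlj := Ed _ _ _ Elj.
  apply: le_lt_trans (dT _ (x j) _) _; rewrite -/(x i) (dC _ l).
  rewrite (splitr r); apply: ltrD; first exact: dij.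
  exact: le_lt_trans dlj nr.
- have /choice[c cP] : forall n, exists c : nat -> X,
    forall y, exists k u, W n u /\ y = c k ** u.
    move=> n; have [c cP] := omega_narrow_seq on (We n); exists c => y.
    by case: (cP y).
  exists (\bigcup_n range (fun k => coset_proj mul H (c n k))).
    apply: bigcup_countable => // n _.
    by apply: sub_countable (card_image_le _ _) _; exact: countableP.
  move=> O Oo [A]; rewrite -(repK A) => OA.
  have [n Wn] := small _ _ Oo (sat O) OA.
  have [k [u [Wu xE]]] := cP n (rep A).
  exists (coset_proj mul H (c n k)); split; last by exists n => //; exists k.
  by apply: Wn; rewrite {1}xE (ginvM hX) (gmulxVK hX); exact: Wi.
Qed.

End Quotient.

(** * Omega-narrowness, cellularity and compact extensions *)

Section Narrow.
Variables (X : topologicalType) (mul : X -> X -> X) (inv : X -> X) (e : X).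
Hypothesis hX : topological_group mul inv e.
Local Notation "x ** y" := (mul x y) (at level 40, left associativity).

(** Moving [U] to [e] by a point [u0] of it gives the covering by left translates; the one by right
    translates follows by applying the hypothesis to inverses. *)
Lemma left_narrow_omega_narrow :
  (forall A, nbhs e A -> exists2 C, countable C &
    forall x, exists2 c, C c & A (inv c ** x)) -> omega_narrow mul.
Proof.
move=> H U Uo [u0 Uu0].
have N0 : nbhs u0 U by exact: open_nbhs_nbhs.
have N1 := (nbhs_left hX _ _).1 N0.
have N2 : nbhs e [set z | U (inv z ** u0)].
  have := (nbhs_right hX _ _).1 N0.
  by rewrite -{1}(ginv1 hX) => /(ginv_nbhs hX).
have [C1 cC1 C1P] := H _ N1; have [C2 cC2 C2P] := H _ N2.
exists ([set c ** inv u0 | c in C1] `|` [set inv u0 ** inv c | c in C2]).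
  by apply: countable_setU; apply: sub_countable (card_image_le _ _) _.
split; apply/seteqP; split => // x _.
  have [c Cc /= Uc] := C1P x; exists (c ** inv u0); first by left; exists c.
  exists (u0 ** (inv c ** x)) => //.
  by rewrite (gmulA hX) (gmulxVK hX) (gmulVK hX).
have [c Cc /= Uc] := C2P (inv x); exists (inv (inv c ** inv x) ** u0) => //.
exists (inv u0 ** inv c); first by right; exists c.
by rewrite (gmulA hX) (gmulxK hX) (ginvM hX) !(ginvK hX) (gmulxK hX).
Qed.

Lemma lindelof_omega_narrow : lindelof X -> omega_narrow mul.
Proof.
move=> lX; apply: left_narrow_omega_narrow => A Ae.
pose tr c := [set x | A^° (inv c ** x)].
have [O [c _ <-]||G [GF cG] GX] := lX (range tr).
- by apply: gmull_open hX _ _ _; exact: open_interior.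
- apply/seteqP; split => // x _; exists (tr x); first by exists x.
  by rewrite /tr /= (gmulVx hX).
have /choice[c cP] : forall O, exists c, G O -> O = tr c.
  move=> O; have [/GF[c _ <-]|nG] := pselect (G O); first by exists c.
  by exists e.
exists [set c O | O in G]; first exact: sub_countable (card_image_le _ _) _.
move=> x; have : setT x by []; rewrite -GX => -[O GO Ox].
exists (c O); first by exists O.
by move: Ox; rewrite {1}(cP O GO) => /interior_subset.
Qed.

(** The centres of a maximal disjoint family of translates of [V^°] form the required countable set:
    any other translate meets one of the family. *)
Lemma ccc_omega_narrow : countably_cellular X -> omega_narrow mul.
Proof.
move=> ccX; apply: left_narrow_omega_narrow => A /(nbhs_cube hX)[V [Ve Vi V3]].
pose tr c := [set x | V^° (inv c ** x)].
have tr_self c : tr c c by rewrite /tr /= (gmulVx hX).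
have [C [_ tC maxC]] := ex_maximal_disjoint_subcollection tr setT.
exists C.
  have trI : {in C &, injective tr}.
    move=> a b; rewrite !inE => Ca Cb ab; apply: tC => //.
    by exists a; split=> //; rewrite -ab.
  rewrite -(eq_countable (inj_card_eq trI)); apply: ccX.
    by move=> _ [c _ <-]; apply: gmull_open hX _ _ _; exact: open_interior.
  move=> _ _ [a Ca <-] [b Cb <-] ab; apply/eqP; apply: contrapT => /negP/set0P.
  by move=> /(tC _ _ Ca Cb) eab; apply: ab; rewrite eab.
move=> x; apply: contrapT => nx.
have nxC c : C c -> ~ (tr c `&` tr x !=set0).
  move=> Cc [z [/interior_subset Vcz /interior_subset Vxz]]; apply: nx; exists c => //.
  have := V3 _ _ _ Vcz (Vi _ Vxz) (nbhs_singleton Ve).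
  by rewrite (gmulx1 hX) (ginvM hX) (ginvK hX) (gmulA hX) (gmulxK hX).
apply: (maxC (C `|` [set x])) => //.
  split; first exact: subsetUl.
  move=> /(_ x (or_intror erefl)) Cx; apply: (nxC x Cx).
  by exists x; split; exact: tr_self.
move=> a b [Ca|->] [Cb|->] //.
- exact: tC.
- by move=> /(nxC _ Ca).
- by rewrite setIC => /(nxC _ Cb).
Qed.

(* If [W] also satisfies requirements attached to countably many members of the
   family, chosen to meet each translate [c k W n] that some member meets, then
   every member of the family meets, hence is, one of the chosen ones. *)
Lemma complete_omega_narrow_ccc U : @complete_sequence X U -> omega_narrow mul ->
  countably_cellular X.
Proof.
move=> Uc on F Fo Fd.
have [V trapV] := complete_trapping hX Uc.
(* Each nonempty member [O] gets a marked point [x] and a neighbourhood [B] of [e] with [x B B]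
   inside [O]. *)
have /choice[p pP] : forall O, exists p : X * set X, nbhs e p.2 /\
    (F O -> O !=set0 -> forall a b, p.2 a -> p.2 b -> O (p.1 ** a ** b)).
  move=> O; have [[FO [x Ox]]|nO] := pselect (F O /\ O !=set0); last first.
    by exists (e, setT); split=> [|FO O0]; [exact: filterT|case: nO].
  have /(nbhs_left hX)/(nbhs_cube hX)[B [Be Bi B3]] : nbhs x O.
    by apply: open_nbhs_nbhs; split=> //; exact: Fo.
  exists (x, B); split=> // _ _ a b Ba Bb.
  have := B3 _ _ _ Ba Bb (nbhs_singleton Be).
  by rewrite /= (gmulx1 hX) (gmulA hX).
have /choice[c cP] : forall A, exists c : nat -> X, nbhs e A ->
    forall x, exists k, A (inv (c k) ** x).
  move=> A; have [Ae|nA] := pselect (nbhs e A); last by exists (fun=> e).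
  have [c cP] := omega_narrow_seq on Ae; exists c => _ x.
  by have [[k [u [Au ->]]] _] := cP x; exists k; rewrite (gmulKV hX).
pose meets A x O := [/\ F O, O !=set0 &
  exists z, A (inv x ** z) /\ (p O).2 (inv (p O).1 ** z)].
(* Among the members whose marked neighbourhood [x B] meets [c k A], one is chosen; its [B] becomes
   the [k]-th requirement below [A]. *)
have /choice[a aP] : forall Ak : set X * nat, exists O,
    (exists O', meets Ak.1 (c Ak.1 Ak.2) O') -> meets Ak.1 (c Ak.1 Ak.2) O.
  move=> [A k] /=.
  have [[O HO]|nO] := pselect (exists O', meets A (c A k) O'); first by exists O.
  by exists set0.
pose Phi A k := (p (a (A, k))).2.
have [W niceW] : exists W, nice_sequence mul inv e V Phi W.
  apply: (exists_nice_sequence hX); first by case: trapV.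
  by move=> A k _; exact: (pP _).1.
have [We Wi _ _ Wm] := niceW.
suff sub : F `<=` [set set0] `|` \bigcup_n range (fun k => a (W n, k)).
  apply: sub_countable (subset_card_le sub) _.
  apply: countable_setU; first exact: countable1.
  apply: bigcup_countable => // n _.
  by apply: sub_countable (card_image_le _ _) _; exact: countableP.
move=> O FO; have [O0|] := pselect (O = set0); [by left|move=> /eqP/set0P O0].
right; pose x := (p O).1; have [Ue UO] := pP O.
have [n nP] := nice_small hX trapV niceW Ue.
have [k kP] := cP (W n.+1) (We n.+1) x.
have [|Fb b0 [z [Wz bz]]] := aP (W n.+1, k).
  exists O; split=> //; exists x; split=> //.
  by rewrite /x (gmulVx hX); exact: nbhs_singleton.
exists n.+1 => //; exists k => //; move: Fb b0 bz; set b := a _ => Fb b0 bz.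
have [|u [h [Uu Hh xz]]] := nP (inv x ** z).
  have := nice_prod hX niceW (Wi _ _ kP) Wz.
  by rewrite (ginvM hX) (ginvK hX) (gmulA hX) (gmulxK hX).
apply: contrapT => /eqP; rewrite eq_sym => /eqP Ob.
(* Since [z = x ** u ** h], the point is also [z ** inv h]. Here [h] is in the core, so [inv h]
   satisfies the requirement attached to [b], which keeps [z ** inv h] in [b]. *)
have : (O `&` b) (x ** u).
  split.
    have := UO FO O0 u e Uu (nbhs_singleton Ue).
    by rewrite (gmulx1 hX).
  have [m mP] := Wm n.+1 k.
  have bh : (p b).2 (inv h).
    by apply: mP; apply: (core_inv niceW Hh).
  have := (pP b).2 Fb b0 _ _ bz bh.
  have -> : z = x ** u ** h by rewrite -(gmulA hX) -xz (gmulVK hX).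
  by rewrite (gmulVK hX) (gmulxK hX).
by rewrite (Fd _ _ FO Fb Ob).
Qed.

End Narrow.

(** * Pulling properties back along a quotient map with compact kernel *)

Section CompactExtension.
Local Open Scope ring_scope.
Variables (X : topologicalType) (mul : X -> X -> X) (inv : X -> X) (e : X).
Hypothesis hX : topological_group mul inv e.
Local Notation "x ** y" := (mul x y) (at level 40, left associativity).
Variable H : set X.
Hypotheses (nH : normal_subgroup mul inv e H) (cH : compact H).
Local Notation Q := (cosets mul H).
Local Notation pi := (coset_proj mul H).
Variable d : Q -> Q -> Rreal.
Hypotheses (dE : forall x y, d x y = 0 <-> x = y)
  (dC : forall x y, d x y = d y x)
  (dT : forall x y z, d x z <= d x y + d y z)
  (dop : forall A, coset_space_open mul H A <-> metric_open d A).

Let He : H e. Proof. by case: nH. Qed.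

Lemma coset_ball_open A r : open [set y | d A (pi y) < r].
Proof.
apply: ((dop [set B | d A B < r]).2 _) => B AB.
exists (r - d A B); first by rewrite subr_gt0.
move=> C BC; apply: le_lt_trans (dT _ B _) _.
by rewrite -ltrBrDl.
Qed.

(** A tube lemma: by compactness of [H], the cosets contained in an open [N] form an open set of the
    quotient. Equivalently, the projection is closed. *)
Lemma coset_tube N x : open N -> (forall h, H h -> N (x ** h)) ->
  exists2 r, 0 < r & forall y, d (pi x) (pi y) < r -> forall h, H h -> N (y ** h).
Proof.
move=> No xN.
have : metric_open d [set A : Q | forall y, sval A y -> N y].
  apply/dop; rewrite /coset_space_open openE => y /= yN.
  have : \forall y' \near y, H `<=` (fun h => N (y' ** h)).
    move: cH; rewrite compact_near_coveringP; apply=> h Hh.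
    have Nyh : nbhs (y ** h) N.
      by apply: open_nbhs_nbhs; split=> //; apply: yN; exists h.
    have [B [C [By Ch BC]]] := gmul_nbhs hX Nyh.
    by exists (C, B) => //= -[h' y'] [/= Ch' By']; exact: BC.
  by apply: filterS => y' y'N _ [h Hh <-]; exact: y'N.
move=> /(_ (pi x))[|r r0 rN]; first by move=> _ [h Hh <-]; exact: xN.
by exists r => // y /rN yN h Hh; apply: yN; exists h.
Qed.

(** Were no countable subfamily enough, the parts of [H] left uncovered by them would lie in an
    ultrafilter. It converges to some [h] in [H], and a single member of [F] around [x ** h] gives a
    contradiction. *)
Lemma coset_countable_cover F x : (forall U, F U -> open U) ->
  \bigcup_(U in F) U = setT ->
  exists2 G : set (set X), G `<=` F /\ countable G &
    forall h, H h -> exists2 U, G U & U (x ** h).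
Proof.
move=> Fo FX; apply: contrapT => nG.
pose B (G : set (set X)) := [set h | H h /\ forall U, G U -> ~ U (x ** h)].
have [|G1 G2 [G1F cG1] [G2F cG2]|G [GF cG]|E EU EB] :=
  @ultra_of_base X _ [set G | G `<=` F /\ countable G] B.
- by exists set0; split=> //; exact: countable0.
- exists (G1 `|` G2).
    by split; [rewrite subUset|exact: countable_setU].
  by move=> h [Hh GU]; split; split=> // U GU'; apply: GU; [left|right].
- apply: contrapT => B0; apply: nG; exists G => // h Hh; apply: contrapT => nU.
  by apply: B0; exists h; split=> // U GU Uxh; apply: nU; exists U.
have EH : E H.
  have : E (B set0) by apply: EB; split=> //; exact: countable0.
  by apply: filterS => h [].
have [h [Hh Eh]] : H `&` [set h | E --> h] !=set0.
  by move: cH; rewrite compact_ultra; apply.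
have : setT (x ** h) by []; rewrite -FX => -[U FU Uxh].
have EUx : E [set h | U (x ** h)].
  apply: Eh; apply: (gmull_nbhs hX); apply: open_nbhs_nbhs; split=> //.
  exact: Fo.
have EU1 : E (B [set U]) by apply: EB; split=> [_ -> //|]; exact: countable1.
by have [k [/= Uk [_ /(_ U erefl)]]] := filter_ex (filterI EUx EU1).
Qed.

(** For [q] in [D] and each [k], fix a countable subfamily covering the preimage of the ball of
    radius [2^-k] at [q], whenever one exists. By [coset_tube] every point lies in such a
    preimage. *)
Lemma compact_extension_lindelof (D : set Q) : countable D ->
  (forall O, coset_space_open mul H O -> O !=set0 -> O `&` D !=set0) -> lindelof X.
Proof.
move=> cD Dd F Fo FX.
pose good (q : Q) k (G : set (set X)) := [/\ G `<=` F, countable G &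
  forall y, d q (pi y) < 2^-1 ^+ k -> exists2 U, G U & U y].
have /choice[G GP] : forall qk : Q * nat, exists G,
    (G `<=` F /\ countable G) /\
    ((exists G', good qk.1 qk.2 G') -> good qk.1 qk.2 G).
  move=> [q k]; have [[G Gg]|nG] := pselect (exists G', good q k G').
    by exists G; split=> //; case: Gg.
  by exists set0; split=> //; split=> //; exact: countable0.
exists (\bigcup_(qk in D `*` setT) G qk).
  split; first by move=> U [qk _]; exact: (GP qk).1.1.
  apply: bigcup_countable; last by move=> qk _; exact: (GP qk).1.2.
  by apply: countableX => //; exact: countableP.
apply/seteqP; split=> // x _.
have [G0 [G0F cG0] G0x] := coset_countable_cover x Fo FX.
have [||r r0 rP] := @coset_tube (\bigcup_(U in G0) U) x.
- by apply: bigcup_open => U /G0F; exact: Fo.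
- by move=> h /G0x[U GU Ux]; exists U.
have [n nr] := @half_expn_lt _ (r / 2) ltac:(by rewrite divr_gt0).
have n0 : 0 < (2^-1 : Rreal) ^+ n by rewrite exprn_gt0 // invr_gt0.
have [||q [xq Dq]] := Dd [set B | d (pi x) B < 2^-1 ^+ n].
- exact: coset_ball_open.
- by exists (pi x); rewrite /= (dE _ _).2.
have [|_ _ /(_ x)] := (GP (q, n)).2.
  exists G0; split=> // y qy.
  have [|U GU] := rP y _ e He.
    apply: le_lt_trans (dT _ q _) _; rewrite (splitr r); apply: ltrD.
      exact: lt_trans nr.
    exact: lt_trans nr.
  by rewrite (gmulx1 hX) => Uy; exists U.
rewrite dC => -[//|U GU Ux]; exists U => //; by exists (q, n).
Qed.

(** [U n] consists of the open sets whose images have all distances below [2^-n]. An ultrafilter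
    meeting all of them has image converging to a coset, and compactness of this coset yields a
    limit upstairs. *)
Lemma compact_extension_complete :
  (forall u : nat -> Q,
     (forall eps : Rreal, 0 < eps -> exists N, forall m n,
         (N <= m)%N -> (N <= n)%N -> d (u m) (u n) < eps) ->
     exists l, forall eps : Rreal, 0 < eps -> exists N, forall n,
         (N <= n)%N -> d (u n) l < eps) ->
  exists2 U, @complete_sequence X U & forall n (x : X), exists2 A, U n A & A x.
Proof.
move=> dcomp.
pose U n : set (set X) :=
  [set A | open A /\ forall x y, A x -> A y -> d (pi x) (pi y) < 2^-1 ^+ n].
have h0 n : 0 < (2^-1 : Rreal) ^+ n by rewrite exprn_gt0 // invr_gt0.
have Ucov n x : exists2 A, U n A & A x.
  exists [set y | d (pi x) (pi y) < 2^-1 ^+ n.+1]; last by rewrite /= (dE _ _).2.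
  split; first exact: coset_ball_open.
  move=> y z /= xy xz; apply: le_lt_trans (dT _ (pi x) _) _.
  have := h0 n; move: xy xz; rewrite dC exprS; lra.
exists U => //; split.
- by move=> n A [].
- by move=> n W Wo [x Wx]; have [A UA Ax] := Ucov n x; exists A => //; exists x.
move=> F FU FUn.
have /choice[A AP] : forall n, exists A, U n A /\ F A.
  by move=> n; have [A] := FUn n; exists A.
have /choice[x xP] : forall n, exists x, A n x.
  by move=> n; apply: filter_ex (AP n).2.
have hle m n : (m <= n)%N -> (2^-1 : Rreal) ^+ n <= 2^-1 ^+ m.
  by move=> mn; apply: ler_wiXn2l => //; lra.
have [eps eps0|l lP] := dcomp (fun n => pi (x n)).
  have [N Neps] := @half_expn_lt _ (eps / 2) ltac:(by rewrite divr_gt0).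
  exists N => m n Nm Nn; have [z [Az Az']] := filter_ex (filterI (AP m).2 (AP n).2).
  have := (AP m).1.2 _ _ (xP m) Az; have := (AP n).1.2 _ _ Az' (xP n).
  have := dT (pi (x m)) (pi z) (pi (x n)); have := hle _ _ Nm; have := hle _ _ Nn.
  move=> /=; lra.
have [y yl] := coset_proj_surj l; rewrite -{}yl in lP.
have Fball eps : 0 < eps -> F [set z | d (pi y) (pi z) < eps].
  move=> eps0; have eps20 : 0 < eps / 2 by rewrite divr_gt0.
  have [N Neps] := half_expn_lt eps20; have [M Meps] := lP _ eps20.
  apply: filterS (AP (maxn N M)).2 => z Az /=.
  have := (AP (maxn N M)).1.2 _ _ (xP _) Az; have := Meps _ (leq_maxr N M).
  have := dT (pi y) (pi (x (maxn N M))) (pi z); have := hle _ _ (leq_maxl N M).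
  rewrite (dC (pi y) (pi (x _))) /=; lra.
(* If no point of the coset is a limit, compactness gives [B] in [F] and a neighbourhood [C] of [e]
   such that [B] misses [y H C]. *)
apply: contrapT => nF.
have : filter_prod F (nbhs e)
    [set zu | H `<=` (fun h => zu.1 <> y ** h ** zu.2)].
  move: cH; rewrite compact_near_coveringP.
  move=> /(_ _ _ (fun (zu : X * X) h => zu.1 <> y ** h ** zu.2)).
  move=> /(_ (filter_prod F (nbhs e)) _); apply=> h Hh.
  have [N Nyh FN] : exists2 N, nbhs (y ** h) N & F (~` N).
    by apply: (not_cvg_ultra FU) => Fyh; exact: (nF (ex_intro _ (y ** h) Fyh)).
  rewrite -(gmulx1 hX (y ** h)) in Nyh.
  have [B [C [Byh Ce BC]]] := gmul_nbhs hX Nyh.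
  exists ([set h' | B (y ** h')], (~` N) `*` C).
    by split; [exact: (gmull_nbhs hX)|exists (~` N, C)].
  move=> [h' [z u]] /= [Bh' [Nz Cu]] zE; apply: Nz; rewrite zE; exact: BC.
move=> [[B C] /= [FB Ce] BC].
(* This open set contains [y H], hence a tube around it; the tube belongs to [F] and so meets
   [B]. *)
pose O := \bigcup_(h in H) [set z | C^° (inv (y ** h) ** z)].
have [||r r0 rP] := @coset_tube O y.
- by apply: bigcup_open => h _; apply: gmull_open hX _ _ _; exact: open_interior.
- by move=> h Hh; exists h; rewrite //= (gmulVx hX).
have [z [/= Bz /rP/(_ e He)]] :=
  filter_ex (filterI FB (Fball r r0)).
rewrite (gmulx1 hX) => -[h Hh /interior_subset Cz].
by apply: (BC (z, inv (y ** h) ** z) _ h) => //=; rewrite (gmulVK hX).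
Qed.

End CompactExtension.

(** * Cech-completeness from complete covers *)

(** In the closure of [range j], let [W n] be the union of the open sets whose trace lies in the
    image of a member of [U n]. A point of all [W n] is the limit of an ultrafilter of [X] meeting
    every [U n]; this one converges in [X], so the point is in the range. *)
Lemma closure_range_cech (X P : topologicalType) (j : X -> P) U :
  hausdorff_space P -> continuous j -> injective j ->
  (forall A : set X, open A -> exists2 V : set P, open V & V `&` range j = j @` A) ->
  compact (closure (range j)) ->
  @complete_sequence X U -> (forall n (x : X), exists2 A, U n A & A x) ->
  cech_complete X.
Proof.
move=> hP jc ji jo cR [Uo _ Uc] Ucov.
pose K : topologicalType := set_type (closure (range j)).
have jR x : closure (range j) (j x) by apply: subset_closure; exists x.
pose k x : K := exist _ (j x) (mem_set (jR x)).
have vc : continuous (set_val : K -> P) by exact: initial_continuous.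
have Knbhs (p : K) N : nbhs p N -> exists2 B : set P, nbhs (set_val p) B &
    set_val @^-1` B `<=` N.
  rewrite nbhsE => -[O [[B Bo <-] Bp] BN]; exists B => //.
  exact: open_nbhs_nbhs.
exists K, k; split.
- rewrite compact_ultra => F FU _.
  have FR : F (set_val @^-1` closure (range j)).
    by apply: filterE => p; exact: set_valP.
  have [p [Rp Fp]] : closure (range j) `&` [set p | set_val @ F --> p] !=set0.
    move: cR; rewrite compact_ultra; apply => //; exact: ultra_map.
  exists (exist _ p (mem_set Rp)); split => // N /Knbhs[B Bp BN].
  exact: (@filterS _ F _ _ N BN (Fp _ Bp)).
- move=> p q pq; apply: val_inj; apply: hP => A B Ap Bq.
  by have [r [Ar Br]] := pq _ _ (vc _ _ Ap) (vc _ _ Bq); exists (set_val r).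
- split.
  + move=> x N /Knbhs[B Bx BN].
    by apply: (@filterS _ (nbhs x) _ _ _ _ (jc _ _ Bx)) => y By; exact: BN.
  + by move=> x y /(congr1 set_val) /ji.
  + move=> A /jo[V Vo VA]; exists (set_val @^-1` V); first by exists V.
    apply/seteqP; split=> [_ [x Ax <-]|p [/= Vp [x _ xp]]].
      by split; [have : (j @` A) (j x) by [exists x]; rewrite -VA => -[]|exists x].
    rewrite -{}xp in Vp *.
    have : (j @` A) (j x) by rewrite -VA; split=> //; exists x.
    by move=> [y Ay /ji yx]; exists x => //; rewrite -yx.
- pose W n := \bigcup_(V in [set V | open V /\ exists2 A, U n A &
    V `&` range j `<=` j @` A]) V.
  exists (fun n => set_val @^-1` W n).
    by move=> n; exists (W n) => //; apply: bigcup_open => V [].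
  apply/seteqP; split=> [_ [x _ <-] n _|p pW].
    have [A UA Ax] := Ucov n x; have [V Vo VA] := jo A (Uo _ _ UA).
    exists V; first by split=> //; exists A => //; rewrite VA.
    by have : (j @` A) (j x) by [exists x]; rewrite -VA => -[].
  have pR : closure (range j) (set_val p) by exact: set_valP.
  have [|B C pB pC|B pB|F FU FB] := @ultra_of_base X _ (nbhs (set_val p))
      (fun B => j @^-1` B).
  - by exists setT; exact: filterT.
  - by exists (B `&` C) => //; exact: filterI.
  - by have [_ [[x _ <-] Bx]] := pR _ pB; exists x.
  have [n|x Fx] := Uc F FU.
    have [V [Vo [A UA VA]] Vp] := pW n I; exists A => //.
    have NV : nbhs (set_val p) V by exact: open_nbhs_nbhs.
    apply: filterS (FB _ NV) => x Vx.
    have : (V `&` range j) (j x) by split=> //; exists x.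
    by move=> /VA[y Ay /ji <-].
  exists x => //; apply: val_inj; apply: (@cvg_unique P hP (j @ F)).
  + by move=> B /jc /Fx.
  + by move=> B pB; exact: FB.
Qed.

Lemma completely_regular_cech (X : topologicalType) U : hausdorff_space X ->
  (forall (x : X) N, nbhs x N -> exists g : X -> Rreal,
    [/\ continuous g, forall y, (0 <= g y <= 1)%R, g x = 0%R &
        forall y, ~ N y -> g y = 1%R]) ->
  @complete_sequence X U -> (forall n (x : X), exists2 A, U n A & A x) ->
  cech_complete X.
Proof.
move=> hX cr Uc Ucov.
pose good (g : X -> Rreal) := continuous g /\ forall y, (0 <= g y <= 1)%R.
(* The index set is that of all functions; the unsuitable ones are replaced by zero, so that [X] is
   mapped into a cube. *)
pose f (g : X -> Rreal) : X -> Rreal := if `[< good g >] then g else fun=> 0%R.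
have fgood g : good (f g).
  rewrite /f; case: asboolP => // _; split=> [|y]; last by rewrite lexx ler01.
  exact: cst_continuous.
have sepf : separate_points_from_closed f.
  move=> C x Cc nCx.
  have Nx : nbhs x (~` C).
    by apply: open_nbhs_nbhs; split=> //; exact: closed_openC.
  have [g [gc g01 gx gC]] := cr x _ Nx; exists g.
  have -> : f g = g by rewrite /f asboolT.
  rewrite gx => cl0.
  have B0 : nbhs (0%R : Rreal) [set r : Rreal | (r < 1)%R].
    apply: open_nbhs_nbhs; split; [exact: open_lt|exact: ltr01].
  have [_ [[y Cy <-] /=]] := cl0 _ B0.
  by rewrite gC ?ltxx //; exact.
have fc i : continuous (f i) by exact: (fgood i).1.
apply: (@closure_range_cech _ _ (join_product f) U) => //.
- by apply: hausdorff_product => _; exact: Rhausdorff.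
- exact: join_product_continuous.
- have ji := join_product_inj sepf (hausdorff_accessible hX).
  by move=> x y xy; apply: ji; rewrite ?inE.
- move=> A Ao.
  have /open_subspaceP[V Vo VA] := join_product_open sepf Ao.
  exists V => //; rewrite VA; apply/seteqP; split=> [y []//|_ [x Ax <-]].
  by split; exists x.
- pose box := [set p : forall g : X -> Rreal, Rreal |
    forall g, `[0%R, 1%R]%classic (p g)].
  have cbox : compact (box : set (prod_topology (fun _ : X -> Rreal => Rreal))).
    have := @tychonoff (X -> Rreal) (fun=> Rreal : topologicalType)
      (fun=> `[0%R, 1%R]%classic) (fun=> @segment_compact Rreal 0%R 1%R).
    exact.
  apply: (subclosed_compact _ cbox); first exact: closed_closure.
  have /closure_id -> : closed (box : set (prod_topology (fun _ : X -> Rreal => Rreal))).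
    apply: compact_closed => //; apply: hausdorff_product => _; exact: Rhausdorff.
  apply: closureS => _ [x _ <-] g /=; rewrite in_itv /=.
  exact: (fgood g).2.
Qed.

(** * Almost completeness of K-analytic Baire spaces *)

Section Meager.
Variable X : topologicalType.
Implicit Types A O W : set X.

(** Phrased with dense open sets, rather than nowhere dense ones, to match [baire]. *)
Definition meager A := exists G : nat -> set X,
  (forall n, open (G n) /\ dense (G n)) /\ forall x, A x -> ~ forall n, G n x.

Lemma dense_setT : dense [set: X].
Proof. by move=> O [x Ox] _; exists x. Qed.

Lemma meager_set0 : meager set0.
Proof. by exists (fun=> setT); split=> // n; split; [exact: openT|exact: dense_setT]. Qed.

Lemma meager_bigcup (A : nat -> set X) :
  (forall n, meager (A n)) -> meager (\bigcup_n A n).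
Proof.
move=> /choice[G GP].
exists (fun m => if unpickle m is Some (i, n) then G i n else setT); split.
  move=> m; case: (unpickle m) => [[i n]|]; first exact: (GP i).1.
  by split; [exact: openT|exact: dense_setT].
move=> x [i _ Aix] Gx; apply: ((GP i).2 x Aix) => n.
by have := Gx (pickle (i, n)); rewrite pickleK.
Qed.

Lemma meager_subset A B : A `<=` B -> meager B -> meager A.
Proof. by move=> AB [G [Gd GB]]; exists G; split=> // x /AB; exact: GB. Qed.

(** Take a maximal disjoint family of open subsets of [W] on which [A] is meager. By maximality its
    union is dense in [W]; by disjointness the witnesses [G O n] for its members glue, for each [n],
    into one dense open set. *)
Lemma banach_category A W : open W ->
  (forall O, open O -> O !=set0 -> O `<=` W ->
     exists O', [/\ open O', O' !=set0, O' `<=` O & meager (A `&` O')]) ->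
  meager (A `&` W).
Proof.
move=> Wo locW.
pose D := [set O | [/\ open O, O !=set0, O `<=` W & meager (A `&` O)]].
have [E [ED tE maxE]] := ex_maximal_disjoint_subcollection (@id (set X)) D.
have /choice[G GP] : forall O, exists G : nat -> set X, D O ->
    (forall n, open (G n) /\ dense (G n)) /\
    forall x, (A `&` O) x -> ~ forall n, G n x.
  move=> O; have [[_ _ _ [G GO]]|nO] := pselect (D O); first by exists G.
  by exists (fun=> setT).
exists (fun n => (\bigcup_(O in E) (O `&` G O n)) `|` (~` W)^°).
split=> [n|x [Ax Wx] Gx].
  split.
    apply: openU; last exact: open_interior.
    apply: bigcup_open => O EO; have DO := ED _ EO.
    by apply: openI; [case: DO|exact: ((GP _ DO).1 n).1].
  move=> T [x Tx] To; have [[y [Ty Wy]]|TW] := pselect (T `&` W !=set0); last first.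
    exists x; split=> //; right; apply: filterS (open_nbhs_nbhs (conj To Tx)).
    by move=> y Ty Wy; apply: TW; exists y.
  have [|||O' [O'o [z O'z] O'T mO']] := locW (T `&` W).
  - exact: openI.
  - by exists y.
  - by move=> ? [].
  have DO' : D O' by split=> //; [exists z|move=> u /O'T[]].
  have [O [EO OO']] : exists O, E O /\ O `&` O' !=set0.
    apply: contrapT => nO.
    have dO O : E O -> ~ (O `&` O' !=set0).
      by move=> EO OO'; apply: nO; exists O.
    apply: (maxE (E `|` [set O'])).
    - split; first exact: subsetUl.
      by move=> /(_ O' (or_intror erefl)) /dO; apply; exists z.
    - by move=> O [/ED|->].
    - move=> a b [Ea|->] [Eb|->] //; first exact: tE.
      + by move=> /(dO _ Ea).
      + by rewrite setIC => /(dO _ Eb).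
  have DO := ED _ EO.
  have [u [[Ou O'u] Gu]] := ((GP _ DO).1 n).2 (O `&` O') OO'
    (openI (let: And4 h _ _ _ := DO in h) O'o).
  by exists u; split; [have [] := O'T _ O'u|left; exists O].
have EG n : exists O, [/\ E O, O x & G O n x].
  by have [[O EO [Ox Gxn]]|/interior_subset] := Gx n; [exists O|].
have [O [EO Ox _]] := EG 0%N.
apply: ((GP _ (ED _ EO)).2 x) => [//|n].
have [O' [EO' O'x GO'x]] := EG n.
by have -> : O = O' by apply: tE => //; exists x.
Qed.

Lemma baire_not_meager A O : baire X -> open O -> O !=set0 -> O `<=` A ->
  ~ meager A.
Proof.
move=> bX Oo O0 OA [G [Gd GA]].
have [x [Ox Gx]] := bX G Gd O O0 Oo.
by apply: (GA x (OA x Ox)) => n; exact: Gx.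
Qed.

End Meager.

(* [A s] is the image of the piece of [Y] coded by [s]; a filter containing, for
   every [s], a set on which [A s] is nowhere locally nonmeager or some
   [A (i :: s)] is everywhere locally nonmeager, singles out a branch along which
   it contains the closures of the [A s]. *)
Lemma K_analytic_baire_complete (X : topologicalType) :
  regular_space X -> K_analytic X -> baire X ->
  exists U, @complete_sequence X U.
Proof.
move=> rX [Y [g [lY cY gc gX]]] bX.
have [UY [UYo _ UYc] UYcov] := cech_complete_sequence cY.
have /choice[V VP] : forall n, exists V : nat -> set Y,
    (forall y, exists i, V i y) /\ (forall i y, V i y -> UY n (V i)).
  move=> n; have [||G [GU cG] GY] := lY (UY n); first exact: UYo.
    apply/seteqP; split=> // y _; have [A UA Ay] := UYcov n y; by exists A.
  have [c cP] := countable_enum set0 cG.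
  (* The enumeration may take values outside [UY n]; these are emptied. *)
  exists (fun i => [set y | c i y /\ UY n (c i)]); split.
    move=> y; have : setT y by []. rewrite -GY => -[A GA Ay].
    by have [i _ ci] := cP A GA; exists i; rewrite /= ci; split=> //; exact: GU.
  move=> i y [_ Uci]; rewrite (_ : [set z | _] = c i) //.
  by apply/seteqP; split=> z; [case|].
(* Codes carry the latest digit first, so [i :: s] refines [s]; the digit at depth [n] picks a
   member of the [n]-th countable cover. *)
pose B := fix B (s : seq nat) :=
  if s is i :: s' then B s' `&` V (size s') i else [set: Y].
pose A s := g @` B s.
have AS s : A s `<=` \bigcup_i A (i :: s).
  move=> _ [y By <-]; have [i Vi] := (VP (size s)).1 y.
  by exists i => //; exists y.
pose good s W := open W /\ forall O, open O -> O !=set0 -> O `<=` W ->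
  ~ meager (A s `&` O).
have goodS s W O : good s W -> open O -> O `<=` W -> good s O.
  by move=> [_ gW] Oo OW; split=> // T To T0 TO; apply: gW => // x /TO /OW.
have good_closure s W : good s W -> W `<=` closure (A s).
  move=> [Wo gW] x Wx N Nx; apply: contrapT => AN.
  apply: (gW (W `&` N^°)).
  - by apply: openI => //; exact: open_interior.
  - by exists x; split=> //; exact: nbhs_interior.
  - by move=> ? [].
  - apply: meager_subset (@meager_set0 X) => z [Az [_ /interior_subset Nz]].
    by apply: AN; exists z.
pose Us s := [set O : set X | open O /\
  ((forall W, W !=set0 -> W `<=` O -> ~ good s W) \/ exists i, good (i :: s) O)].
(* Let [A s] be locally nonmeager throughout [W']. If no [A (i :: s)] were so on any nonempty open
   part of [W'], each would be meager in [W'] by [banach_category], and [A s] would be too. *)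
have Usd s W : open W -> W !=set0 -> exists2 O, Us s O & O `&` W !=set0.
  move=> Wo W0.
  have [[W' [W'0 W'W gW']]|nW] :=
      pselect (exists W', [/\ W' !=set0, W' `<=` W & good s W']); last first.
    exists W; last by rewrite setIid.
    by split=> //; left => W' W'0 W'W gW'; apply: nW; exists W'.
  have [[i [O [O0 OW' gO]]]|nO] :=
      pselect (exists i O, [/\ O !=set0, O `<=` W' & good (i :: s) O]).
    exists O; first by split; [exact: gO.1|right; exists i].
    by have [x Ox] := O0; exists x; split=> //; exact/W'W/OW'.
  exfalso; apply: (gW'.2 W') => //; first exact: gW'.1.
  apply: (@meager_subset _ _ (\bigcup_i (A (i :: s) `&` W'))).
    by move=> x [/AS[i _ Ax] W'x]; exists i.
  apply: meager_bigcup => i; apply: banach_category; first exact: gW'.1.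
  move=> O Oo O0 OW'; apply: contrapT => nO'; apply: nO; exists i, O; split=> //.
  split=> // T To T0 TO mT; apply: nO'; by exists T.
(* Codes of no sequence receive the family of all open sets, which imposes nothing. *)
exists (fun n => if unpickle n is Some s then Us s else [set O | open O]); split.
- by move=> n O; case: (unpickle n) => [s []|].
- move=> n W Wo W0; case: (unpickle n) => [s|]; first exact: Usd.
  by exists W => //; rewrite setIid.
move=> F FU FUn.
have FUs s : exists2 O, Us s O & F O.
  by have := FUn (pickle s); rewrite pickleK.
have [||s [s0 sP]] := @dependent_choice_nat (seq nat)
    (fun s => exists2 O, good s O & F O) (fun _ s s' => exists i, s' = i :: s) [::].
- exists setT; last exact: filterT.
  split=> [|O Oo O0 _]; first exact: openT.
  apply: (baire_not_meager bX Oo O0) => x Ox; split=> //.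
  by have : setT x by []; rewrite -gX.
- move=> _ t [O gO FO]; have [O' [O'o [nO'|[i gi]]] FO'] := FUs t.
    exfalso; apply: (nO' _ (filter_ex (filterI FO FO'))); first by move=> ? [].
    apply: (goodS _ _ _ gO) => [|? []//]; apply: openI => //; exact: gO.1.
  by exists (i :: t); [exists O'|exists i].
have sz n : size (s n) = n.
  elim: n => [|n IHn]; first by rewrite s0.
  by have [_ [i ->]] := sP n; rewrite /= IHn.
have BS n : exists i, B (s n.+1) = B (s n) `&` V n i.
  by have [_ [i si]] := sP n; exists i; rewrite si /= sz.
have Bdec n : B (s n.+1) `<=` B (s n) by have [i ->] := BS n; move=> ? [].
(* [A (s n)] is dense in an open member of [F], so preimages of open members of [F] meet every
   [B (s n)]. An ultrafilter containing these traces lies in members of all the [UY n]. *)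
have [|[O n] [O' n'] [/= Oo FO] [/= O'o FO']|[O n] [/= Oo FO]|E EU EB] :=
  @ultra_of_base Y (set X * nat)%type [set On | open On.1 /\ F On.1]
    (fun On => g @^-1` On.1 `&` B (s On.2)).
- by exists (setT, 0%N); split; [exact: openT|exact: filterT].
- exists (O `&` O', maxn n n').
    by split; [exact: openI|exact: filterI].
  move=> y [/= [Oy O'y] By].
  by split; split=> //; apply: (decreasing_le Bdec) By; rewrite ?leq_maxl ?leq_maxr.
- have [W gW FW] := (sP n).1.
  have [x [Ox Wx]] := filter_ex (filterI FO FW).
  have [_ [[y By <-] Oy]] := good_closure _ _ gW _ Wx _ (open_nbhs_nbhs (conj Oo Ox)).
  by exists y.
have [n|y Ey] := UYc E EU.
  have EBn : E (B (s n.+1)).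
    have : E (g @^-1` setT `&` B (s n.+1)).
      by apply: (EB (setT, n.+1)); split; [exact: openT|exact: filterT].
    by apply: filterS => ? [].
  have [i BV] := BS n; rewrite BV in EBn.
  have [z [_ Vz]] := filter_ex EBn.
  exists (V n i); first exact: (VP n).2 Vz.
  by apply: filterS EBn => ? [].
(* If [F] missed a neighbourhood of [g y], by regularity it would contain the complement of a
   smaller closed one. Its preimage would then be in [E], which converges to [y]. *)
exists (g y); apply: contrapT => /(not_cvg_ultra FU)[N Ny FN].
have [C Cy CN] := rX _ _ Ny.
have EC : E (g @^-1` (~` closure C) `&` B (s 0%N)).
  apply: (EB (~` closure C, 0%N)); split=> /=.
    by apply: closed_openC; exact: closed_closure.
  by apply: filterS FN => x Nx /CN.
have EgC : E (g @^-1` C) := Ey _ (gc _ _ Cy).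
have [z [[nCz _] Cz]] := filter_ex (filterI EC EgC).
by apply: nCz; exact: subset_closure.
Qed.

(** * The equivalences *)

Lemma lindelof_image (X Y : topologicalType) (g : Y -> X) :
  lindelof Y -> continuous g -> range g = setT -> lindelof X.
Proof.
move=> lY gc gX F Fo FX.
have [||G [GF cG] GY] := lY [set g @^-1` U | U in F].
- by move=> _ [U FU <-]; apply: open_comp (Fo _ FU) => ? _; exact: gc.
- apply/seteqP; split=> // y _; have : setT (g y) by [].
  by rewrite -FX => -[U FU Ugy]; exists (g @^-1` U) => //; exists U.
have /choice[c cP] : forall V, exists U, G V -> F U /\ g @^-1` U = V.
  move=> V; have [/GF[U FU UV]|nG] := pselect (G V); first by exists U.
  by exists setT.
exists (c @` G).
  split; first by move=> _ [V GV <-]; exact: (cP V GV).1.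
  exact: sub_countable (card_image_le _ _) _.
apply/seteqP; split=> // x _; have : setT x by []; rewrite -gX => -[y _ <-].
have : setT y by []; rewrite -GY => -[V GV Vy]; exists (c V); first by exists V.
by move: Vy; rewrite -{1}(cP V GV).2.
Qed.

Lemma polish_on_bij (A B : Type) (f : A -> B) (g : B -> A)
    (opA : set (set A)) (opB : set (set B)) :
  cancel f g -> cancel g f -> (forall O, opA (f @^-1` O) <-> opB O) ->
  polish_on opB -> polish_on opA.
Proof.
move=> fK gK opAB [d [[d0 dC dT dop] [dcomp [D cD Dd]]]].
have opE O : opA O <-> opB (g @^-1` O).
  rewrite -opAB (_ : f @^-1` _ = O) //.
  by apply/seteqP; split=> x; rewrite /= fK.
exists (fun x y => d (f x) (f y)); split; split.
- by move=> x y; rewrite d0; split=> [/(can_inj fK)|->].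
- by move=> x y; exact: dC.
- by move=> x y z; exact: dT.
- move=> O; rewrite opE dop; split=> Om x Ox.
    have [|r r0 rO] := Om (f x); first by rewrite /= fK.
    by exists r => // y /rO; rewrite /= fK.
  have [r r0 rO] := Om _ Ox; exists r => // y xy.
  by apply: rO; rewrite !gK.
- move=> u /dcomp[l lP]; exists (g l) => r /lP[N NP].
  by exists N => n /NP; rewrite gK.
- exists (g @` D); first exact: sub_countable (card_image_le _ _) _.
  move=> O /opE Oo [x Ox].
  have [|y [Oy Dy]] := Dd _ Oo; first by exists (f x); rewrite /= fK.
  by exists (g y); split=> //; exists y.
Qed.

Lemma continuous_dist (R : realType) (X : topologicalType) (g : X -> R) :
  (forall y r, (0 < r)%R -> nbhs y [set z | (`|g y - g z| < r)%R]) -> continuous g.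
Proof. by move=> H y; apply/cvgrPdist_lt => r; exact: H. Qed.

Lemma min_dist_lt (R : realType) (a b t r : R) :
  (a <= b + t -> b <= a + t -> t < r / 2 ->
   `|Num.min 1 (2 * a) - Num.min 1 (2 * b)| < r)%R.
Proof.
move=> ab ba tr; rewrite ltr_norml; apply/andP.
by case: (leP 1 (2 * a))%R => ?; case: (leP 1 (2 * b))%R => ?; split; lra.
Qed.

Section Equivalences.
Variables (X : topologicalType) (mul : X -> X -> X) (inv : X -> X) (e : X).
Hypothesis hX : topological_group mul inv e.
Local Notation "x ** y" := (mul x y) (at level 40, left associativity).

(** A sequence of neighbourhoods starting inside [inv x N] yields a continuous pseudometric, and [g]
    is a truncated multiple of the distance to [x]. *)
Lemma group_completely_regular (x : X) N : nbhs x N -> exists g : X -> Rreal,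
  [/\ continuous g, forall y, (0 <= g y <= 1)%R, g x = 0%R &
      forall y, ~ N y -> g y = 1%R].
Proof.
move=> /(nbhs_left hX) Ne.
have [W [We Wi W3 WN _]] := exists_nice_sequence hX (fun _ : nat => Ne)
  (fun A (_ : nat) (_ : nbhs e A) => filterT : nbhs e setT).
pose E n y z := if n is m.+1 then W m (inv y ** z) else True.
have [||||d [d0 dC dT dE Ed]] := @pseudometrization Rreal X E.
- by [].
- by move=> [//|n] y /=; rewrite (gmulVx hX); exact: nbhs_singleton.
- by move=> [//|n] y z /= /Wi; rewrite (ginvM hX) (ginvK hX).
- move=> [//|n] a b c y /= ab bc cy; have := W3 _ _ _ _ ab bc cy.
  by rewrite !(gmulA hX) (gmulxK hX) (gmulxK hX).
have Enbhs n y : nbhs y [set z | E n y z].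
  case: n => [|n] /=; first exact: filterT.
  by apply/(nbhs_left hX); apply: filterS (We n) => z; rewrite /= (gmulKV hX).
have dxx y : d y y = 0%R.
  apply/eqP; rewrite eq_le d0 andbT leNgt; apply/negP => /half_expn_lt[n].
  by apply/negP; rewrite -leNgt; apply: Ed; exact: (nbhs_singleton (Enbhs n y)).
(* The factor 2 makes [g y < 1] mean [d x y < 2^-1], which is relation [E 1], that is [W 0]. *)
pose g y : Rreal := Num.min 1%R (2 * d x y)%R; exists g; split.
- apply: (@continuous_dist Rreal) => y r r0; rewrite /g.
  have [|n nr] := @half_expn_lt _ (r / 2)%R; first by rewrite divr_gt0.
  apply: filterS (Enbhs n y) => z /Ed yz.
  apply: (@min_dist_lt _ _ _ (d y z)); last exact: le_lt_trans nr.
    by rewrite (dC y); exact: dT.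
  exact: dT.
- by move=> y; rewrite /g ge_min lexx le_min ler01 mulr_ge0.
- by rewrite /g dxx mulr0; apply/min_idPr.
- move=> y nNy; apply/min_idPl; rewrite leNgt; apply/negP => dy; apply: nNy.
  have /WN /= : W 0%N (inv x ** y) by apply: (dE 1%N); rewrite expr1; lra.
  by rewrite (gmulVK hX).
Qed.

(** Intersecting a trapping sequence with the [O n] keeps it trapping and forces the core into every
    [O n]. *)
Lemma complete_omega_narrow_extension U (O : nat -> set X) :
  @complete_sequence X U -> omega_narrow mul -> (forall n, nbhs e (O n)) ->
  exists H, [/\ normal_subgroup mul inv e H, compact H,
    polish_on (coset_space_open mul H) & forall n, H `<=` O n].
Proof.
move=> Uc on Oe; have [V [Ve Vc]] := complete_trapping hX Uc.
have trapVO : trapping e (fun n => V n `&` O n).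
  split=> [n|F FU FV]; first exact: filterI.
  by apply: Vc => n; apply: filterS (FV n) => ? [].
have [Phi PhiP] := normalizing_requirements hX on.
have [||W niceW] := @exists_nice_sequence _ _ _ _ hX (fun n => V n `&` O n) Phi.
- by case: trapVO.
- by move=> A k /PhiP[].
have nH : normal_subgroup mul inv e (\bigcap_n W n).
  by apply: (core_normal hX niceW) => A /PhiP[].
exists (\bigcap_n W n); split=> //.
- exact: (core_compact hX trapVO niceW).
- exact: (core_quotient_polish hX Uc on trapVO niceW nH).
- by move=> n x Hx; have [_ _ _ WVO _] := niceW; have [] := WVO n x (Hx n I).
Qed.

Lemma compact_extension_lindelof_cech H : normal_subgroup mul inv e H ->
  compact H -> polish_on (coset_space_open mul H) -> lindelof X /\ cech_complete X.
Proof.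
move=> nH cH [d [[dE dC dT dop] [dcomp [D cD Dd]]]]; split.
  exact: (compact_extension_lindelof hX nH cH dE dC dT dop cD Dd).
have [U Uc Ucov] := compact_extension_complete hX nH cH dE dC dT dop dcomp.
apply: completely_regular_cech Uc Ucov; last exact: group_completely_regular.
by case: hX => _ [].
Qed.

Lemma lindelof_cech_K_analytic_baire : lindelof X -> cech_complete X ->
  K_analytic X /\ baire X.
Proof.
move=> lX cX; split.
  exists X, id; split=> //; first by move=> x; exact: cvg_id.
  by apply/seteqP; split=> // x _; exists x.
have [U Uc _] := cech_complete_sequence cX.
exact: baire_of_complete_sequence (group_regular hX) Uc.
Qed.

Lemma K_analytic_baire_complete_narrow : K_analytic X -> baire X ->
  (exists U, @complete_sequence X U) /\ omega_narrow mul.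
Proof.
move=> kX bX; split; first exact: K_analytic_baire_complete (group_regular hX) kX bX.
case: kX => [Y [g [lY _ gc gX]]]; apply: (lindelof_omega_narrow hX).
exact: lindelof_image lY gc gX.
Qed.

Lemma trivial_normal_subgroup : normal_subgroup mul inv e [set e].
Proof.
split=> //= [x y -> ->|x ->|x y ->]; first exact: gmul1 hX _.
- exact: ginv1 hX.
- by rewrite (gmulx1 hX) (gmulxV hX).
Qed.

Lemma trivial_quotient_polish : polish_on (coset_space_open mul [set e]) <-> polish X.
Proof.
have /choice[rep repK] : forall A : cosets mul [set e], exists x,
    coset_proj mul [set e] x = A by exact: coset_proj_surj.
have projK : cancel (coset_proj mul [set e]) rep.
  move=> x; have := repK (coset_proj mul _ x).
  move=> /(coset_projP hX _ _ trivial_normal_subgroup)/= xE.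
  have := congr1 (mul (rep (coset_proj mul [set e] x))) xE.
  by rewrite (gmulVK hX) (gmulx1 hX).
split; first exact: (polish_on_bij projK repK).
apply: (polish_on_bij repK projK) => O.
rewrite /coset_space_open (_ : _ @^-1` _ = O) //.
by apply/seteqP; split=> x; rewrite /= projK.
Qed.

End Equivalences.

Theorem theorem6p1 (X : topologicalType) (mul : X -> X -> X) (inv : X -> X)
  (e : X) (hX : topological_group mul inv e) :
  let c1 := K_analytic X /\ baire X in
  let c2 := exists H : set X,
      [/\ normal_subgroup mul inv e H, compact H &
          polish_on (coset_space_open mul H)] in
  let c3 := omega_narrow mul /\ cech_complete X in
  let c4 := lindelof X /\ cech_complete X in
  let c5 := countably_cellular X /\ cech_complete X in
  [/\ (c1 <-> c2), (c1 <-> c3), (c1 <-> c4), (c1 <-> c5) &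
      (countable_pseudocharacter X -> (c1 <-> polish X))].
Proof.
move=> c1 c2 c3 c4 c5.
(* Both [c1] and [c3] imply [c2] through [ext]; then [c2] gives [c4], which gives back [c1] and
   [c3], and [c5] is tied to [c3]. *)
have ext U : @complete_sequence X U -> omega_narrow mul -> c2.
  move=> Uc on.
  have [|||H [nH cH pH _]] := @complete_omega_narrow_extension _ _ _ _ hX U (fun=> setT).
  - exact: Uc.
  - exact: on.
  - by move=> n; exact: filterT.
  by exists H.
have c12 : c1 -> c2.
  move=> [kX bX].
  have [[U Uc] on] := K_analytic_baire_complete_narrow hX kX bX.
  exact: (ext U Uc on).
have c32 : c3 -> c2.
  by move=> [on /cech_complete_sequence[U Uc _]]; exact: (ext U Uc on).
have c24 : c2 -> c4.
  by move=> [H [nH cH pH]]; exact: (compact_extension_lindelof_cech hX nH cH pH).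
have c43 : c4 -> c3.
  by move=> [lX cX]; split=> //; exact: (lindelof_omega_narrow hX lX).
have c41 : c4 -> c1 by move=> [lX cX]; exact: (lindelof_cech_K_analytic_baire hX lX cX).
have c35 : c3 -> c5.
  move=> [on cX]; split=> //; have [U Uc _] := cech_complete_sequence cX.
  exact: (complete_omega_narrow_ccc hX Uc on).
have c53 : c5 -> c3.
  by move=> [cc cX]; split=> //; exact: (ccc_omega_narrow hX cc).
split; [tauto|tauto|tauto|tauto|].
(* Writing [[set e]] as the intersection of the [O n] and placing [H] inside all of them makes [H]
   trivial, so [X] itself is the Polish quotient. *)
move=> /(_ e)[O Oo eO]; split=> [[kX bX]|pX].
  have [[U Uc] on] := K_analytic_baire_complete_narrow hX kX bX.
  have Oe n : nbhs e (O n).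
    apply: open_nbhs_nbhs; split=> //.
    by have : [set e] e by []; rewrite eO; exact.
  have [H [nH _ pH HO]] := complete_omega_narrow_extension hX Uc on Oe.
  apply/(trivial_quotient_polish hX); rewrite (_ : [set e] = H) //.
  apply/seteqP; split=> [x ->|x Hx]; first by case: nH.
  by rewrite eO => n _; exact: HO.
apply/c41/c24; exists [set e]; split; first exact: (trivial_normal_subgroup hX).
  exact: compact_set1.
exact/(trivial_quotient_polish hX).
Qed.
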